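(* Let $P=\{p_1,\ldots,p_m\}$ be a finite poset, let $A_1,\ldots,A_m$ be non-empty subsets of $[n]$, and let $\mathfrak{A}$ be a poset ideal of $\mathrm{Hom}(P,A_1,\ldots,A_m)$. For $i=1,\ldots,m$ let $B_i:=\{a\in A_i\mid f(p_i)=a\text{ for some }f\in\mathfrak{A}\}$, let $V':=\{(p_i,a)\mid 1\le i\le m,\ a\in B_i\}$, and consider $\Delta(\mathfrak{A})$ as a simplicial complex on the vertex set $V'$. Then: (1) $\mathrm{pd}(\mathcal{L}(\mathfrak{A}))\le|B_1|+\cdots+|B_m|-m$; (2) $\mathrm{pd}(\mathcal{L}(\mathfrak{A}))=|B_1|+\cdots+|B_m|-m$ if and only if $\Delta(\mathfrak{A})$ is a simplicial sphere. Here $\mathrm{pd}(\mathcal{L}(\mathfrak{A}))$ denotes the projective dimension of $\mathcal{L}(\mathfrak{A})$.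
   Context: $n$ is a positive integer, $[n]=\{1,\ldots,n\}$, $\mathbf{K}$ is a field, $R=\mathbf{K}[X_{p,i}\mid p\in P,\ i\in[n]]$; $p_i<p_j$ implies $i<j$. $\mathrm{Hom}(P,A_1,\ldots,A_m)$ is the set of maps $f:P\to[n]$ that are isotone ($p\le q$ implies $f(p)\le f(q)$) with $f(p_i)\in A_i$ for all $i$, partially ordered by $f\le g$ iff $f(p)\le g(p)$ for all $p$. A poset ideal of a poset $Q$ is a non-empty subset $I\subseteq Q$ such that $y\in I$, $x\in Q$, $x\le y$ imply $x\in I$. $\mathcal{L}(\mathfrak{A})$ is the ideal of $R$ generated by $U_f=\prod_{p\in P}X_{p,f(p)}$, $f\in\mathfrak{A}$. $\Delta(\mathfrak{A})$ is the Stanley–Reisner complex of the Alexander dual $\mathcal{L}(\mathfrak{A})^{\vee}$, here on the vertex set $V'$ (with $(p_i,a)$ corresponding to $X_{p_i,a}$). Equivalently, its facets are the sets $V'\setminus\Gamma f$, $f\in\mathfrak{A}$, where $\Gamma f=\{(p,f(p))\mid p\in P\}$. A simplicial complex is a simplicial sphere if its geometric realization is homeomorphic to $S^d=\{v\in\mathbf{R}^{d+1}\mid |v|=1\}$ for some $d$. The complex $\{\emptyset\}$ counts as the sphere $S^{-1}=\emptyset$. *)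

(* Defs.v *)
From HB Require Import structures.
From mathcomp Require Import all_boot all_order all_algebra.
From mathcomp Require Import all_classical all_reals topology normedtype.
From mathcomp Require Import -(notations) mpoly.

Set Implicit Arguments.
Unset Strict Implicit.
Unset Printing Implicit Defensive.

Import Order.TTheory GRing.Theory Num.Theory.
Import numFieldNormedType.Exports.
Local Open Scope ring_scope.

Section IdealModule.
Variable R : comNzRingType.

Definition ideal_of (G : set R) : {pred R^o} := fun x =>
  `[< exists s : seq (R * R),
        (forall y, y \in s -> G y.2) /\ x = \sum_(y <- s) y.1 * y.2 >].

Variable G : set R.

Fact ideal_of_submod_closed : submod_closed (ideal_of G).
Proof.
split; first by apply/asboolP; exists [::]; rewrite big_nil.
move=> a x y /asboolP[s [Gs ->]] /asboolP[t [Gt ->]]; apply/asboolP.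
exists ([seq (a * z.1, z.2) | z <- s] ++ t); split.
  by move=> z; rewrite mem_cat => /orP[/mapP[w ws ->]|/Gt//]; apply: Gs ws.
rewrite big_cat big_map /=; congr (_ + _); rewrite /GRing.scale /= mulr_sumr.
by apply: eq_bigr => z _; rewrite mulrA.
Qed.

HB.instance Definition _ :=
  GRing.isSubmodClosed.Build R R^o (ideal_of G) ideal_of_submod_closed.

Record ideal_module := IdealElt { ideal_val : R^o; _ : ideal_val \in ideal_of G }.

HB.instance Definition _ := [isSub for ideal_val].
HB.instance Definition _ := [Choice of ideal_module by <:].
HB.instance Definition _ :=
  [SubChoice_isSubLmodule of ideal_module by <:].

End IdealModule.

Section ProjectiveDimension.
Variable R : pzRingType.

Definition projective_module (Q : lmodType R) : Prop :=
  forall (M N : lmodType R) (g : {linear M -> N}) (h : {linear Q -> N}),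
    (forall y, exists x, g x = y) ->
    exists k : {linear Q -> M}, forall x, g (k x) = h x.

(* [proj_resolution M d]: there is an exact sequence
   0 -> Q_d -> ... -> Q_1 -> Q_0 -> M -> 0 with all Q_i projective;
   it is extended by Q_i = 0 for i > d. *)
Definition proj_resolution (M : lmodType R) (d : nat) : Prop :=
  exists (Q : nat -> lmodType R) (aug : {linear Q 0%N -> M})
         (bd : forall i, {linear Q i.+1 -> Q i}),
  [/\ forall i, projective_module (Q i),
      forall i, (d < i)%N -> forall x : Q i, x = 0,
      forall y, exists x, aug x = y,
      forall x, aug x = 0 <-> exists z, bd 0%N z = x
    & forall i x, bd i x = 0 <-> exists z, bd i.+1 z = x].

Definition pd_eq (M : lmodType R) (d : nat) : Prop :=
  proj_resolution M d /\ forall e, proj_resolution M e -> (d <= e)%N.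

Definition pd_le (M : lmodType R) (d : nat) : Prop :=
  exists2 e, (e <= d)%N & pd_eq M e.

End ProjectiveDimension.

(* [{mpoly K[#|T|]}] is the polynomial ring with one variable for each
    element of the finite type [T]. *)

Section Squarefree.
Variables (K : fieldType) (T : finType).
Local Notation S := (mpoly #|T| K).

Definition Xvar (t : T) : S := mpolyX K (mnm1 (enum_rank t)).

Definition Xmon (F : {set T}) : S := \prod_(t in F) Xvar t.

(* The Alexander dual of a squarefree monomial ideal I is the intersection of
   the primes (X_t : t in G), G the support of a squarefree monomial of I. *)
Definition alexander_dual (I : {pred S}) : {pred S} := fun q =>
  `[< forall G : {set T}, Xmon G \in I ->
        q \in ideal_of [set Xvar t | t in [set` G]]%classic >].

Definition stanley_reisner (V : {set T}) (I : {pred S}) : {set {set T}} :=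
  [set F : {set T} | (F \subset V) && (Xmon F \notin I)].

(* Evaluation at a 0/1 point detects membership in monomial ideals. *)
Definition ev (b : pred T) : S -> K := meval (fun j => (b (enum_val j))%:R).

Fact ev_Xmon b (F : {set T}) : ev b (Xmon F) = (F \subset b)%:R.
Proof.
rewrite /ev /Xmon rmorph_prod /=.
under eq_bigr => t _ do rewrite mevalXU enum_rankK.
have [/fintype.subsetP Fb|/fintype.subsetPn[t tF tb]] := boolP (F \subset b).
  by rewrite big1 // => t /Fb; rewrite unfold_in => ->.
by rewrite (bigD1 t) //=; move: tb; rewrite unfold_in => /negbTE ->; rewrite mul0r.
Qed.

Fact ev_ideal b (G : set S) (q : S) :
  (forall y, G y -> ev b y = 0) -> q \in ideal_of G -> ev b q = 0.
Proof.
move=> G0 /asboolP[s [Gs ->]]; rewrite /ev rmorph_sum /= big_seq big1 // => y ys.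
by rewrite rmorphM /= [X in _ * X](G0 _ (Gs _ ys)) mulr0.
Qed.

Fact mem_ideal (G : set S) (y a : S) : G y -> a * y \in ideal_of G.
Proof.
move=> Gy; apply/asboolP; exists [:: (a, y)]; rewrite big_seq1; split=> // z.
by rewrite inE => /eqP ->.
Qed.

Lemma Xmon_prime (F G : {set T}) :
  (Xmon F \in ideal_of [set Xvar t | t in [set` G]]%classic) = ~~ [disjoint F & G].
Proof.
apply/idP/idP => [FG|].
  apply/negP => dFG; have := @ev_ideal (mem (~: G)%SET) _ _ _ FG.
  have -> : ev (mem (~: G)%SET) (Xmon F) = 1.
    by rewrite ev_Xmon (_ : F \subset _) //; move: dFG; rewrite finset.disjoints_subset.
  suff H : forall y, [set Xvar t | t in [set` G]]%classic y ->
      ev (mem (~: G)%SET) y = 0 by move/(_ H)/eqP; rewrite oner_eq0.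
  by move=> _ [t /= tG <-]; rewrite /ev mevalXU enum_rankK /= inE tG.
rewrite fintype.disjoint_subset => /fintype.subsetPn[t tF]; rewrite inE negbK => tG.
by rewrite /Xmon (bigD1 t) //= mulrC; apply: mem_ideal; exists t.
Qed.

End Squarefree.

Definition homeomorphic (X Y : topologicalType) (A : set X) (B : set Y) : Prop :=
  exists (f : X -> Y) (g : Y -> X),
  [/\ {within A, continuous f}%classic, {within B, continuous g}%classic,
      forall x, A x -> B (f x) /\ g (f x) = x
    & forall y, B y -> A (g y) /\ f (g y) = y].

Section Realization.
Variable R : realType.

(* Barycentric coordinates in R^T. *)
Definition realization (T : finType) (D : {set {set T}}) : set 'rV[R]_#|T| :=
  [set x : 'rV[R]_#|T| | [/\ forall j, 0 <= x 0 j, \sum_j x 0 j = 1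
             & [set t | x 0 (enum_rank t) != 0]%SET \in D]]%classic.

(* The unit sphere of R^k, of dimension k - 1; it is empty for k = 0. *)
Definition unit_sphere (k : nat) : set 'rV[R]_k :=
  [set v : 'rV[R]_k | Num.sqrt (\sum_j v 0 j ^+ 2) = 1]%classic.

Definition simplicial_sphere (T : finType) (D : {set {set T}}) : Prop :=
  exists k, homeomorphic (realization D) (@unit_sphere k).

End Realization.

(* The chain [n] is ['I_n], with values shifted by 1. *)

Section Letterplace.
Variables (disp : Order.disp_t) (P : finPOrderType disp) (m n : nat).
Variables (p : 'I_m -> P) (A : 'I_m -> {set 'I_n}).
Implicit Types (f g : {ffun P -> 'I_n}) (AA : {set {ffun P -> 'I_n}}).

Definition HomP : {set {ffun P -> 'I_n}} :=
  [set f : {ffun P -> 'I_n} |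
    [forall x, forall y, (x <= y)%O ==> (f x <= f y)%N]
    && [forall i, f (p i) \in A i]].

Definition lehom f g : bool := [forall x, (f x <= g x)%N].

Definition poset_ideal (U : finType) (le : rel U) (Q I : {set U}) : Prop :=
  [/\ I != finset.set0, I \subset Q
    & forall x y, y \in I -> x \in Q -> le x y -> x \in I].

(* For a poset ideal AA every Bset is non-empty, so that the truncated
   difference \sum_i #|Bset i| - m is the integer one. *)
Definition Bset AA (i : 'I_m) : {set 'I_n} :=
  [set a in A i | [exists f in AA, f (p i) == a]].

Definition Vset AA : {set P * 'I_n} :=
  \bigcup_(i : 'I_m) [set (p i, a) | a in Bset AA i].

Definition graph f : {set P * 'I_n} := [set (q, f q) | q : P].

Variable K : fieldType.

Definition U_ f : mpoly #|{: P * 'I_n}| K := \prod_(q : P) Xvar K (q, f q).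

Definition Lgens AA : set (mpoly #|{: P * 'I_n}| K) :=
  [set U_ f | f in [set` AA]]%classic.

Definition Lideal AA := ideal_of (Lgens AA).
Definition Lmodule AA := ideal_module (Lgens AA).

Definition Delta AA : {set {set P * 'I_n}} :=
  stanley_reisner (Vset AA) (alexander_dual (Lideal AA)).

Lemma U_E f : U_ f = Xmon K (graph f).
Proof.
rewrite /U_ /Xmon big_imset /=; last by move=> q r _ _ [].
by apply: eq_bigl => q; rewrite inE.
Qed.

Lemma Xmon_Lideal AA (G : {set P * 'I_n}) :
  (Xmon K G \in Lideal AA) = [exists f in AA, graph f \subset G].
Proof.
apply/idP/exists_inP => [GL|[f fAA fG]].
  apply: contrapT => nG; have := @ev_ideal K _ (mem G) _ _ _ GL.
  rewrite ev_Xmon subxx => /(_ _)/eqP; rewrite oner_eq0 => /(_ _)/notF; apply.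
  move=> _ [f /= fAA <-]; rewrite U_E ev_Xmon; case: (boolP (_ \subset _)) => //.
  by move=> fG; case: nG; exists f.
rewrite /Xmon (big_setID (graph f)) /= (finset.setIidPr fG) mulrC -/(Xmon K (graph f)) -U_E.
by apply: mem_ideal; exists f.
Qed.

(* The facets of Delta are the complements in Vset of the graphs. *)
Lemma DeltaE AA (F : {set P * 'I_n}) :
  (F \in Delta AA) = [exists f in AA, F \subset Vset AA :\: graph f].
Proof.
rewrite inE; have -> : (Xmon K F \notin alexander_dual (Lideal AA)) =
    [exists f in AA, [disjoint F & graph f]].
  apply/idP/exists_inP => [/asboolPn/existsNP[G /not_implyP[]]|[f fAA dF]].
    rewrite Xmon_Lideal => /exists_inP[f fAA fG] /negP; rewrite Xmon_prime negbK.
    by exists f => //; apply: disjointWr fG _.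
  apply/asboolPn => /(_ (graph f)); rewrite Xmon_prime dF Xmon_Lideal => H.
  by have := H (introT exists_inP (ex_intro2 _ _ f fAA (subxx _))).
apply/andP/exists_inP => [[FV /exists_inP[f fAA dF]]|[f fAA]].
  by exists f => //; rewrite finset.subsetD FV.
by rewrite finset.subsetD => /andP[-> dF]; split=> //; apply/exists_inP; exists f.
Qed.

End Letterplace.

(* Main.v *)
Require Import Defs.
From HB Require Import structures.
From mathcomp Require Import all_boot all_order all_algebra.
From mathcomp Require Import all_classical all_reals topology normedtype.
From mathcomp Require Import realfun.
From mathcomp Require Import -(notations) finmap monalg.
From mathcomp Require Import -(notations) mpoly.
From mathcomp Require Import ring lra zify.

(** Write [B_q] for the set of values at [q] of the members of [AA], [V] for the
    set of pairs [(q, a)] with [a] in [B_q], and [N = |V| - |P|], which is the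
    number in the statement. A descent of [f] in [AA] is a pair [(q, a)] of [V]
    such that lowering the value of [f] at [q] to [a] gives an isotone map; it
    is then again in [AA]. Descents avoid the graph of [f], so [f] has at most [N]
    of them. Call [f] an apex if it has exactly [N]. Everything depends on whether
    [AA] has an apex.

    Upper bound. Sort [AA] by the sum of the values. The ideal of the earlier
    monomials has, with respect to the monomial of [f], the colon ideal generated
    by the variables of the descents of [f] ([colon_descents]). Hence the ideal has
    linear quotients, and its projective dimension is at most the greatest number
    of descents ([pdim_le_descents]): at most [N], and at most [N - 1] if there is
    no apex.

    With an apex, [AA] is the full product of the sets [B_q] ([apex_full]). The
    ideal is then a product of ideals generated by disjoint blocks of variables.
    The product of the boundaries of the top cells of these blocks is a Koszul
    cycle of degree [N] with coefficients in the ideal; its coefficients have too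
    small a degree for it to be a boundary. As Koszul homology of a module
    vanishes above its projective dimension, this dimension is at least [N]
    ([koszul_degree_bound]). The complex is the join of the boundaries of the
    simplices on the sets [B_q], and coordinates relative to one vertex of each
    block identify it with the unit sphere of an [N]-dimensional space
    ([apex_sphere]).

    Without an apex, the complex is a retract of the full simplex on [V]
    ([retract_avoid_complex]): the sets that are not faces can be matched in
    pairs and removed by elementary collapses. Brouwer's fixed point theorem
    passes to retracts, whereas the antipodal map of a sphere has no fixed point
    ([not_sphere]). So the complex is no sphere, while the projective dimension
    is less than [N].

    Brouwer's theorem is obtained from a lemma of Scarf on finite sets with
    several linear orders ([scarf]), a parity argument that needs no
    triangulation. *)

Set Implicit Arguments.
Unset Strict Implicit.
Unset Printing Implicit Defensive.

Import Order.TTheory GRing.Theory Num.Theory.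
Import numFieldNormedType.Exports.

(** * Scarf's lemma on families of linear orders *)

Section Counting.

Lemma subset_cardS (T : finType) (A B : {set T}) :
  A \subset B -> #|B| = #|A|.+1 -> exists2 x, x \notin A & B = x |: A.
Proof.
move=> AB cardB; have /eqP/cards1P[x xE] : #|B :\: A| = 1.
  by rewrite cardsD (finset.setIidPr AB) cardB subSnn.
have xBA : x \in B :\: A by rewrite xE set11.
exists x; first by case/setDP: xBA.
by rewrite -{1}(setID B A) (finset.setIidPr AB) xE finset.setUC.
Qed.

(** Pigeonhole with an excess of one: a single fibre has two points. This is
    what makes doors meet two rooms and rooms have two doors. *)
Lemma imset_eq_setD1 (T U : finType) (f : T -> U) (A : {set T}) :
  #|A| = #|f @: A|.+1 ->
  exists x y, [/\ x \in A, y \in A, x != y & f x = f y] /\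
    forall z, z \in A -> (f @: (A :\ z) == f @: A) = (z \in [set x; y]).
Proof.
move=> cardA.
have /dinjectivePn[x xA [y /andP[yx yA] fxy]] : ~~ dinjectiveb f A.
  apply/negP => /dinjectiveP/card_in_imset cE.
  by have := leqnn #|A|; rewrite {1}cardA cE ltnn.
exists x, y; split; first by split=> //; rewrite eq_sym.
move=> z zA; apply/eqP/idP => [fz|].
  have inj_z : {in A :\ z &, injective f}.
    apply/imset_injP; rewrite fz.
    by move/eqP: cardA; rewrite (cardsD1 z A) zA add1n eqSS eq_sym.
  rewrite !inE; apply: contraT; rewrite negb_or => /andP[zx zy].
  have xyE : x = y.
    apply: inj_z => //; rewrite !inE ?xA ?yA andbT; [move: zx|move: zy];
      by apply: contraNneq => ->.
  by rewrite xyE eqxx in yx.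
have drop u v : u \in A -> v \in A -> u != v -> f u = f v -> f @: (A :\ u) = f @: A.
  move=> uA vA uv fuv; apply/eqP; rewrite finset.eqEsubset imsetS ?subsetDl //=.
  apply/fintype.subsetP => _ /imsetP[w wA ->].
  have [->|wu] := eqVneq w u; last by apply: imset_f; rewrite !inE wu.
  by rewrite fuv; apply: imset_f; rewrite !inE vA eq_sym uv.
rewrite !inE => /orP[] /eqP ->; first by apply: (drop x y) => //; rewrite eq_sym.
exact: (drop y x).
Qed.

(** Handshake argument: counting the edges of a bipartite graph from both sides
    shows that the number of vertices of odd degree is even. *)
Lemma odd_degree_unique (W Z : finType) (w0 : W) (inc : W -> Z -> bool) :
  (forall z, ~~ odd #|[set w | inc w z]|) ->
  ~ forall w, odd #|[set z | inc w z]| = (w == w0).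
Proof.
move=> evenZ oddW.
have : odd (\sum_w #|[set z | inc w z]|).
  rewrite (bigD1 w0) //= oddD oddW eqxx.
  rewrite addTb; elim/big_ind: _ => //= [x y|w /negbTE ww0].
    by rewrite oddD => /negbTE -> /negbTE ->.
  by rewrite oddW ww0.
have -> : \sum_w #|[set z | inc w z]| = \sum_z #|[set w | inc w z]|.
  under eq_bigr do rewrite -sum1dep_card big_mkcond.
  rewrite exchange_big; apply: eq_bigr => z _.
  by rewrite -big_mkcond sum1dep_card.
apply/negP; elim/big_ind: _ => // x y.
by rewrite oddD => /negbTE -> /negbTE ->.
Qed.

End Counting.

Section Scarf.
Variables (X I : finType) (rk : I -> X -> nat) (x0 : X).
Hypothesis rk_inj : forall i, injective (rk i).
Implicit Types (s t : {set X}) (C D : {set I}) (i j k : I) (x y z : X).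

Definition above s i y := [exists x in s, rk i x < rk i y].

(** No point of [X] lies above the least point of [s] in all the orders of [C].
    For grid points ordered by their coordinates, dominant pairs play the part of
    the cells of a triangulation. *)
Definition dominant s C := [forall y, exists i in C, ~~ above s i y].

(** The [i]-least point of [s]; the default [x0] only serves the empty set. *)
Definition mn s i := odflt x0 [pick x in s | [forall y in s, rk i x <= rk i y]].

Lemma mnP s i : s != finset.set0 -> mn s i \in s /\ forall y, y \in s -> rk i (mn s i) <= rk i y.
Proof.
move=> /set0Pn[x xs]; rewrite /mn; case: pickP => [z /andP[zs /forall_inP]|none] //.
case: (arg_minnP (rk i) xs) => z zs zmin.
by have /negbT/negP[] := none z; apply/andP; split=> //; apply/forall_inP.
Qed.

Lemma mn_eq s i x : x \in s -> (forall y, y \in s -> rk i x <= rk i y) -> mn s i = x.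
Proof.
move=> xs xmin; have s0 : s != finset.set0 by apply/set0Pn; exists x.
have [ms mmin] := mnP i s0.
by apply: (@rk_inj i); apply/eqP; rewrite eqn_leq mmin ?xmin.
Qed.

Lemma aboveE s i y : s != finset.set0 -> above s i y = (rk i (mn s i) < rk i y).
Proof.
move=> s0; have [ms mmin] := mnP i s0; apply/exists_inP/idP => [[x xs]|lt].
  by apply: leq_ltn_trans; exact: mmin.
by exists (mn s i).
Qed.

Lemma aboveS s t i y : s \subset t -> above s i y -> above t i y.
Proof. by move=> /fintype.subsetP st /exists_inP[x /st xt lt]; apply/exists_inP; exists x. Qed.

Lemma dominantP s C :
  reflect (forall y, exists2 i, i \in C & ~~ above s i y) (dominant s C).
Proof.
by apply: (iffP forallP) => H y; [have /exists_inP := H y | apply/exists_inP].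
Qed.

Lemma dominantPn s C : ~~ dominant s C -> exists y, forall i, i \in C -> above s i y.
Proof.
move=> /forallPn[y]; rewrite negb_exists_in => /forall_inP H.
by exists y => i /H; rewrite negbK.
Qed.

Lemma dominantS s t C D : t \subset s -> C \subset D -> dominant s C -> dominant t D.
Proof.
move=> ts /fintype.subsetP CD /dominantP H; apply/dominantP => y.
by have [i /CD iD Hi] := H y; exists i => //; apply: contra Hi; exact: aboveS.
Qed.

(** Otherwise [x] itself would lie above all the least points. *)
Lemma dominant_mn s C x : dominant s C -> x \in s -> exists2 i, i \in C & mn s i = x.
Proof.
move=> /dominantP/(_ x)[i iC nab] xs; exists i => //; apply: mn_eq => // y ys.
by rewrite leqNgt; apply: contra nab => lt; apply/exists_inP; exists y.
Qed.

Lemma dominant_imset s C : s != finset.set0 -> dominant s C -> mn s @: C = s.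
Proof.
move=> s0 dom; apply/setP => x; apply/imsetP/idP => [[i _ ->]|xs].
  by case: (mnP i s0).
by have [i iC <-] := dominant_mn dom xs; exists i.
Qed.

Lemma mnU1 t i x : t != finset.set0 -> mn (x |: t) i != x -> mn (x |: t) i = mn t i.
Proof.
move=> t0 ne; have xt0 : x |: t != finset.set0 by apply/set0Pn; exists x; rewrite setU11.
have [ms mmin] := mnP i xt0; apply/esym/mn_eq.
  by move: ms; rewrite !inE (negbTE ne).
by move=> y yt; apply: mmin; rewrite setU1r.
Qed.

Variable c : X -> I.
Local Notation vtx := ({set X} * {set I})%type.
Implicit Types w v : vtx.
Variable i0 : I.

(** Rooms are the top cells. A door is a cell of codimension one that carries all
    the labels of its indices but [i0]; it may lack a point or have an extra
    index compared with the rooms it opens into. *)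
Definition room (z : {set X} * {set I}) := (#|z.1| == #|z.2|) && dominant z.1 z.2.

Definition door (w : {set X} * {set I}) :=
  [&& #|w.1|.+1 == #|w.2|, dominant w.1 w.2, i0 \in w.2 & c @: w.1 == w.2 :\ i0].

Definition adjacent (w z : {set X} * {set I}) :=
  (z.2 == w.2) && (w.1 \subset z.1) || (z.1 == w.1) && (z.2 \subset w.2).

Lemma adjacentP w (z : vtx) : #|w.1|.+1 = #|w.2| -> #|z.1| = #|z.2| -> adjacent w z ->
  (exists2 x, x \notin w.1 & z = (x |: w.1, w.2)) \/
  (exists2 k, k \in w.2 & z = (w.1, w.2 :\ k)).
Proof.
case: w z => [t C] [s D] /= cw cz /orP[] /= /andP[/eqP e sub]; subst.
  left; have [|x xt ->] := subset_cardS sub; last by exists x.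
  by rewrite cw.
right; have [|k kD CE] := subset_cardS sub; last first.
  by exists k; rewrite CE ?setU11 // setU1K.
by rewrite -cw -cz.
Qed.

(** The outer door: it opens only into the room of the [i0]-greatest point. *)
Lemma adjacent_start :
  odd #|[set z : vtx | [&& door (finset.set0, [set i0]), room z & adjacent (finset.set0, [set i0]) z]]|.
Proof.
have door0 : door (finset.set0, [set i0]).
  rewrite /door /= cards0 cards1 set11 imset0 finset.setDv !eqxx /= andbT.
  apply/dominantP => y; exists i0; rewrite ?set11 //.
  by apply/exists_inP => -[x]; rewrite inE.
case: (arg_maxnP (rk i0) (isT : xpredT x0)) => x _ xmax'.
have xmax y : rk i0 y <= rk i0 x by exact: xmax'.
rewrite (_ : [set _ | _] = [set ([set x], [set i0])]) ?cards1 //.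
apply/setP => z; rewrite !inE door0 /=; apply/andP/eqP => [[cz fz]|->].
  have [cardz domz] := andP cz.
  have := adjacentP _ (eqP cardz) fz; rewrite /= cards0 cards1 => /(_ erefl).
  move=> [[y _ zE]|[k]]; last first.
    rewrite inE => /eqP -> zE; move: domz; rewrite zE /= finset.setDv.
    by move=> /dominantP/(_ x)[i]; rewrite inE.
  rewrite zE finset.setU0 in domz *; congr ([set _], _).
  move: domz => /dominantP/(_ x)[i]; rewrite inE => /eqP -> /exists_inPn/(_ y).
  rewrite set11 => /(_ isT); rewrite -leqNgt => xy.
  by apply: (@rk_inj i0); apply/eqP; rewrite eqn_leq xy xmax.
rewrite /room /adjacent /= !cards1 !eqxx finset.sub0set; split=> //=.
apply/dominantP => y; exists i0; rewrite ?set11 //.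
by apply/exists_inP => -[z']; rewrite inE => /eqP ->; rewrite ltnNge xmax.
Qed.

(** A door [(t, C)] has one index more than points, so two indices [i] and [j]
    have the same least point. Either one may be chosen: dropping it from [C]
    gives a room, or else some points lie above [t] in all the other orders, and
    the best of them for this index is added to [t]. *)
Lemma adjacent_door w : door w -> w != (finset.set0, [set i0]) ->
  ~~ odd #|[set z : vtx | [&& door w, room z & adjacent w z]]|.
Proof.
move=> ww w_neq; have := ww; case: w ww w_neq => t C /= ww w_neq.
move=> /and4P[/eqP/= cardC dom i0C /eqP imt].
have t0 : t != finset.set0.
  apply: contra w_neq => /eqP t0; rewrite t0; apply/eqP; congr (_, _).
  by apply/eqP; rewrite eq_sym eqEcard finset.sub1set i0C cards1 -cardC t0 cards0.
have [|i [j [[iC jC ij mnij] _]]] := @imset_eq_setD1 _ _ (mn t) C.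
  by rewrite dominant_imset.
have inj_room s D : #|s| = #|D| -> s != finset.set0 -> dominant s D -> {in D &, injective (mn s)}.
  by move=> cardD s0 domD; apply/imset_injP; rewrite dominant_imset // cardD.
pose M k y := [forall l in C :\ k, above t l y].
pose best k := odflt x0 [pick x | M k x & [forall y, M k y ==> (rk k y <= rk k x)]].
have bestP k : ~~ dominant t (C :\ k) ->
    M k (best k) /\ forall y, M k y -> rk k y <= rk k (best k).
  move=> /dominantPn[y /(introT forall_inP) My].
  rewrite /best; case: pickP => [z /andP[Mz /forallP zmax]|none].
    by split=> // u Mu; have := zmax u; rewrite Mu.
  case: (@arg_maxnP _ y (M k) (rk k) My) => z Mz zmax.
  have /negbT/negP[] := none z; apply/andP; split=> //; apply/forallP => u.
  by apply/implyP; exact: zmax.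
pose nb k := if dominant t (C :\ k) then (t, C :\ k) else (best k |: t, C).
have Mdom k y : k \in C -> M k y -> ~~ above t k y.
  move=> kC /forall_inP My; have /dominantP/(_ y)[l lC] := dom.
  by have [->//|lk] := eqVneq l k; rewrite My // !inE lk.
have room_nb k l : k \in C -> l \in C -> k != l -> mn t k = mn t l -> room (nb k).
  move=> kC lC kl mnkl; rewrite /room /nb; case: ifP => [dk|/negbT/bestP[Mb bmax]] /=.
    by rewrite dk andbT -eqSS cardC (cardsD1 k C) kC.
  have Mbl : above t l (best k) by apply: (forall_inP Mb); rewrite !inE eq_sym kl.
  have bt : best k \notin t.
    apply/negP => bt; have [h hC mh] := dominant_mn dom bt.
    have := erefl (rk l (best k)); have [hk|hk] := eqVneq h k.
      by move: Mbl; rewrite hk in mh; rewrite aboveE // -mnkl mh ltnn.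
    have : above t h (best k) by apply: (forall_inP Mb); rewrite !inE hk.
    by rewrite aboveE // mh ltnn.
  rewrite cardsU1 bt add1n cardC eqxx /=; apply/dominantP => y.
  have [My|] := boolP (M k y); last first.
    rewrite negb_forall_in => /exists_inP[h /setD1P[hk hC] nab]; exists h => //.
    apply: contra nab => /exists_inP[z /setU1P[->|zt] lt]; last first.
      by apply/exists_inP; exists z.
    have /exists_inP[u ut ltu] : above t h (best k) by apply: (forall_inP Mb); rewrite !inE hk.
    by apply/exists_inP; exists u => //; exact: ltn_trans lt.
  exists k => //; apply/exists_inP => -[z /setU1P[->|zt]].
    by rewrite ltnNge bmax.
  move=> lt; have := Mdom k y kC My; apply/negP/negPn.
  by apply/exists_inP; exists z.
have adjacent_nb k : k \in C -> adjacent (t, C) (nb k).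
  move=> kC; rewrite /adjacent /nb; case: ifP => _ /=.
    by rewrite eqxx subD1set orbT.
  by rewrite eqxx finset.subsetUr.
have nb_inj : nb i != nb j.
  apply/eqP; rewrite /nb; case: ifP => [_|/negbT/bestP[Mi _]];
    case: ifP => [_|/negbT/bestP[Mj _]] [].
  - by move=> /setP/(_ i); rewrite !inE eqxx iC ij.
  - by move=> _ /setP/(_ i); rewrite !inE eqxx iC.
  - by move=> _ /setP/(_ j); rewrite !inE eqxx jC.
  - move=> bij; have bt : best i \notin t.
      apply/negP => bt; have [h hC mh] := dominant_mn dom bt.
      have [hi|hi] := eqVneq h i.
        have : above t j (best i) by apply: (forall_inP Mi); rewrite !inE eq_sym ij.
        by rewrite hi in mh; rewrite aboveE // -mnij mh ltnn.
      have : above t h (best i) by apply: (forall_inP Mi); rewrite !inE hi.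
      by rewrite aboveE // mh ltnn.
    have : best i \in best j |: t by rewrite -bij setU11.
    rewrite !inE (negbTE bt) orbF => /eqP bE.
    have := Mdom i _ iC Mi; rewrite bE => /negP[].
    by apply: (forall_inP Mj); rewrite !inE ij.
rewrite (_ : [set _ | _] = [set nb i; nb j]) ?cards2 ?nb_inj //.
apply/setP => z; rewrite !inE ww /=; apply/andP/orP => [[cz fz]|]; last first.
  by case=> /eqP ->; rewrite adjacent_nb //; split=> //;
    [apply: (room_nb i j) | apply: (room_nb j i); rewrite // eq_sym].
have [/eqP cardz domz] := andP cz.
have [[x xt zE]|[k kC zE]] := @adjacentP (t, C) z cardC cardz fz; rewrite zE /= in cardz domz *.
  have xt0 : x |: t != finset.set0 by apply/set0Pn; exists x; rewrite setU11.
  have inj_x := inj_room _ _ cardz xt0 domz.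
  have [k kC mk] := dominant_mn domz (setU11 x t).
  have mnE l : l \in C -> l != k -> mn (x |: t) l = mn t l.
    move=> lC lk; apply: mnU1 => //; apply: contra lk => /eqP ml.
    by apply/eqP/inj_x => //; rewrite ml mk.
  have Mx : M k x.
    apply/forall_inP => l /setD1P[lk lC]; rewrite aboveE // -(mnE l) //.
    have [_ lmin] := mnP l xt0.
    rewrite ltn_neqAle lmin ?setU11 // andbT; apply: contra lk => /eqP/rk_inj ml.
    by apply/eqP/inj_x => //; rewrite ml mk.
  have zk : (x |: t, C) = nb k.
    rewrite /nb ifN; last first.
      apply/negP => /dominantP/(_ x)[l lC]; apply/negP/negPn.
      exact: (forall_inP Mx).
    have ndom : ~~ dominant t (C :\ k).
      apply/negP => /dominantP/(_ x)[l lC]; apply/negP/negPn.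
      exact: (forall_inP Mx).
    have [Mb bmax] := bestP k ndom.
    congr (_ |: _, _); apply: (@rk_inj k); apply/eqP; rewrite eqn_leq bmax //=.
    have /dominantP/(_ (best k))[l lC] := domz.
    have [->|lk] := eqVneq l k.
      by move=> /exists_inPn/(_ x (setU11 _ _)); rewrite -leqNgt.
    move=> /negP[]; apply: (aboveS (s := t)); first exact: finset.subsetUr.
    by apply: (forall_inP Mb); rewrite !inE lk.
  have : k \in [set i; j].
    rewrite !inE; apply: contraT; rewrite negb_or => /andP[ki kj].
    by have := ij; rewrite (inj_x i j) ?eqxx // !mnE // eq_sym.
  by rewrite !inE zk => /orP[] /eqP ->; rewrite eqxx; [left|right].
have inj_k := inj_room _ _ cardz t0 domz.
have zk : (t, C :\ k) = nb k by rewrite /nb domz.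
have : k \in [set i; j].
  rewrite !inE; apply: contraT; rewrite negb_or => /andP[ki kj].
  by have := ij; rewrite (inj_k i j) ?eqxx // !inE ?iC ?jC eq_sym ?ki ?kj.
by rewrite !inE zk => /orP[] /eqP ->; rewrite eqxx; [left|right].
Qed.

(** A path of rooms that does not stop here leaves by a second door: either two
    points share a label, and each of them may be left out, or a label lies
    outside [C], and its point may be left out or the label added to [C]. *)
Lemma adjacent_room (z : vtx) : room z -> c @: z.1 != z.2 ->
  ~~ odd #|[set w | [&& door w, room z & adjacent w z]]|.
Proof.
move=> cz; have := cz; case: z cz => s C cz /andP[/eqP/= cardC dom] nfull.
have inP w : (w \in [set w | [&& door w, room (s, C) & adjacent w (s, C)]]) ->
   [/\ w.2 = C, i0 \in C & exists2 x, x \in s & w.1 = s :\ x /\ c @: (s :\ x) = C :\ i0] \/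
   [/\ w.1 = s, i0 \in C & exists2 i, i \notin C & w.2 = i |: C /\ c @: s = i |: (C :\ i0)].
  rewrite inE => /and3P[/and4P[/eqP cw _ i0w /eqP imw] _ fw].
  have [[x xw [sE CE]]|[k kw [sE CE]]] := @adjacentP w (s, C) cw cardC fw.
    left; rewrite CE; split=> //; exists x; first by rewrite sE setU11.
    by rewrite sE setU1K.
  have kC : k \notin C by rewrite CE !inE eqxx.
  have wE : w.2 = k |: C by rewrite CE finset.setD1K.
  have ki0 : k != i0.
    apply: contra nfull => /eqP ki0; rewrite /= sE imw wE -ki0 setU1K //.
  right; split=> //.
    by rewrite CE !inE eq_sym ki0.
  exists k => //; split=> //; rewrite sE imw wE finset.setDUl.
  by congr (_ :|: _); apply/finset.setDidPl; rewrite disjoints1 inE.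
have [w0|[w ww]] := set_0Vmem [set w | [&& door w, room (s, C) & adjacent w (s, C)]].
  by rewrite w0 cards0.
have i0C : i0 \in C by case: (inP w ww) => -[].
have door_x x : x \in s -> c @: (s :\ x) = C :\ i0 ->
    (s :\ x, C) \in [set w | [&& door w, room (s, C) & adjacent w (s, C)]].
  move=> xs imx; rewrite inE cz /door /adjacent /= imx !eqxx subD1set i0C !andbT.
  rewrite -cardC (cardsD1 x s) xs eqxx /=.
  by apply: dominantS dom => //; exact: subD1set.
have door_i i : i \notin C -> c @: s = i |: (C :\ i0) ->
    (s, i |: C) \in [set w | [&& door w, room (s, C) & adjacent w (s, C)]].
  move=> iC ims; rewrite inE cz /door /adjacent /= ims eqxx finset.subsetUr !inE i0C !orbT.
  rewrite cardsU1 iC cardC eqxx /= andbT; apply/andP; split.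
    by apply: dominantS dom => //; exact: finset.subsetUr.
  rewrite finset.setDUl eq_sym; apply/eqP; congr (_ :|: _).
  apply/finset.setDidPl; rewrite disjoints1 inE.
  by apply: contraNneq iC => ->.
have : c @: s = C :\ i0 \/ exists2 i, i \notin C & c @: s = i |: (C :\ i0).
  case: (inP w ww) => [[_ _ [x xs [_ imx]]]|[_ _ [i iC [_ ims]]]]; last first.
    by right; exists i.
  have ims : c @: s = c x |: (C :\ i0) by rewrite -{1}(finset.setD1K xs) imsetU1 imx.
  have [cxC|cxC] := boolP (c x \in C); last by right; exists (c x).
  have [cx0|cx0] := eqVneq (c x) i0.
    by case/negP: nfull; rewrite /= ims cx0 finset.setD1K.
  by left; rewrite ims; apply/finset.setUidPr; rewrite finset.sub1set !inE cx0.
move=> [ims|[i iC ims]].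
  have [|x [y [[xs ys xy _] twoP]]] := @imset_eq_setD1 _ _ c s.
    by rewrite ims cardC (cardsD1 i0 C) i0C.
  rewrite (_ : [set _ | _] = [set (s :\ x, C); (s :\ y, C)]).
    rewrite cards2; case: eqP => //= -[/setP/(_ x)].
    by rewrite !inE eqxx xs (negbTE xy).
  apply/setP => v; apply/idP/set2P => [|vE].
    move=> /inP[[v2 _ [z zs [v1 imz]]]|[_ _ [i iC [_ ims']]]]; last first.
      have : i \in C :\ i0 by rewrite -ims ims' setU11.
      by rewrite !inE (negbTE iC) andbF.
    have : z \in [set x; y] by rewrite -twoP // imz ims.
    by case: v v1 v2 => v1' v2' /= -> -> /set2P[] ->; [left|right].
  have imE u : u \in s -> u \in [set x; y] -> c @: (s :\ u) = C :\ i0.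
    by move=> us uxy; rewrite -ims; apply/eqP; rewrite twoP.
  by case: vE => ->; apply: door_x => //; apply: imE => //; rewrite !inE eqxx ?orbT.
have /imsetP[x xs ix] : i \in c @: s by rewrite ims setU11.
have inj_s : {in s &, injective c}.
  apply/imset_injP; rewrite ims cardsU1 !inE (negbTE iC) andbF cardC.
  by rewrite (cardsD1 i0 C) i0C.
have imx : c @: (s :\ x) = C :\ i0.
  apply/setP => k; apply/imsetP/idP => [[u /setD1P[ux us] ->]|kC].
    have : c u \in i |: (C :\ i0) by rewrite -ims imset_f.
    move=> /setU1P[cu|//]; case/negP: ux; apply/eqP/inj_s => //.
    by rewrite cu ix.
  have /imsetP[u us ku] : k \in c @: s by rewrite ims setU1r.
  exists u => //; rewrite !inE us andbT; apply: contraTneq kC => ux.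
  by rewrite ku ux -ix !inE (negbTE iC) andbF.
rewrite (_ : [set _ | _] = [set (s :\ x, C); (s, i |: C)]).
  rewrite cards2; case: eqP => //= -[/setP/(_ x)].
  by rewrite !inE eqxx xs.
apply/setP => v; apply/idP/set2P => [|[]->]; [|exact: door_x|exact: door_i].
move=> /inP[[v2 _ [z zs [v1 imz]]]|[v1 _ [k kC [v2 ims']]]].
  left; case: v v1 v2 => v1' v2' /= -> ->; congr (_ :\ _, _).
  apply: inj_s => //; have : i \in c @: s by rewrite ims setU11.
  rewrite -(finset.setD1K zs) imsetU1 imz !inE (negbTE iC) andbF orbF => /eqP <-.
  by rewrite ix.
right; case: v v1 v2 => v1' v2' /= -> ->; congr (_, _ |: _).
have : k \in i |: (C :\ i0) by rewrite -ims ims' setU11.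
by rewrite !inE (negbTE kC) andbF orbF => /eqP.
Qed.

(** If no room carries exactly the labels of its indices, all rooms and all doors
    have even degree, except for the outer door. *)
Theorem scarf : exists s C, [/\ #|s| = #|C|, dominant s C, C != finset.set0 & c @: s = C].
Proof.
suff [[s C] /andP[cz /eqP/= full]] : exists z : vtx, room z && (c @: z.1 == z.2).
  have [/eqP/= cardC dom] := andP cz; exists s, C; split=> //.
  by apply/eqP => C0; have /dominantP/(_ x0)[i] := dom; rewrite /= C0 inE.
apply/existsP; apply: contraT => /existsPn none.
pose inc (w z : vtx) := [&& door w, room z & adjacent w z].
case: (@odd_degree_unique _ _ (finset.set0, [set i0]) inc).
  move=> z; have [cz|ncz] := boolP (room z); last first.
    rewrite (_ : [set _ | _] = finset.set0) ?cards0 //.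
    by apply/setP => w; rewrite !inE /inc (negbTE ncz) andbF.
  by apply: adjacent_room => //; have := none z; rewrite cz.
move=> w; have [->|w_neq] := eqVneq w (finset.set0, [set i0]); first exact: adjacent_start.
have [ww|nww] := boolP (door w); first by apply/negbTE/adjacent_door.
by rewrite (_ : [set _ | _] = finset.set0) ?cards0 //; apply/setP => z; rewrite !inE /inc (negbTE nww).
Qed.

End Scarf.

(** * Brouwer's fixed point theorem for a simplex *)

Local Open Scope ring_scope.

Lemma continuous_sum (R : realType) (X : topologicalType) (I : Type) (r : seq I)
    (Q : pred I) (F : I -> X -> R) :
  (forall i, Q i -> continuous (F i)) -> continuous (fun x => \sum_(i <- r | Q i) F i x).
Proof.
have addc : continuous (fun z : R * R => z.1 + z.2).
  by move=> z; apply: cvgD; [exact: cvg_fst | exact: cvg_snd].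
by move=> cF; exact: (continuous_big addc).
Qed.

Lemma continuous_bigmin (R : realType) (X : topologicalType) (I : Type) (r : seq I)
    (Q : pred I) (c : R) (F : I -> X -> R) :
  (forall i, Q i -> continuous (F i)) ->
  continuous (fun x => \big[Num.min/c]_(i <- r | Q i) F i x).
Proof.
have minc : continuous (fun z : R * R => Num.min z.1 z.2) by exact: min_continuous.
by move=> cF; exact: (continuous_big minc).
Qed.

Section Grid.
Variables (k M : nat) (V : {set 'I_k}).
Hypothesis V0 : V != finset.set0.

Definition grid_pred (g : {ffun 'I_k -> 'I_M.+1}) : bool :=
  (\sum_j (g j : nat) == M)%N && [forall j, (j \notin V) ==> (g j == 0 :> nat)].

Definition grid := {g | grid_pred g}.

Definition gc (x : grid) (j : 'I_k) : nat := sval x j.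

Lemma grid_sum (x : grid) : (\sum_j gc x j)%N = M.
Proof. by apply/eqP; case/andP: (svalP x). Qed.

Lemma grid_out (x : grid) j : j \notin V -> gc x j = 0%N.
Proof. by move=> jV; have /andP[_ /forallP/(_ j)] := svalP x; rewrite jV => /eqP. Qed.

Lemma grid_ex (y : 'I_k -> nat) : (\sum_j y j)%N = M ->
  (forall j, j \notin V -> y j = 0%N) -> exists x : grid, forall j, gc x j = y j.
Proof.
move=> sumy outy.
have ltM j : (y j < M.+1)%N by rewrite ltnS -sumy (bigD1 j) //= leq_addr.
pose g := [ffun j => Ordinal (ltM j)].
have gP : grid_pred g.
  apply/andP; split; first by rewrite -[X in _ == X]sumy; apply/eqP/eq_bigr => j _; rewrite ffunE.
  by apply/forallP => j; apply/implyP => /outy yj; rewrite ffunE /= yj.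
by exists (exist _ g gP) => j; rewrite /gc /= ffunE.
Qed.

(** The order by the [i]-th coordinate, ties being broken by an enumeration of the
    grid. *)
Definition grid_rank (i : 'I_k) (x : grid) : nat := (gc x i * #|{: grid}| + enum_rank x)%N.

Lemma grid_rank_inj i : injective (grid_rank i).
Proof.
move=> x y; rewrite /grid_rank => xy.
have rx := ltn_ord (enum_rank x); have ry := ltn_ord (enum_rank y).
apply: enum_rank_inj; apply: val_inj => /=.
have := congr1 (modn^~ #|{: grid}|) xy.
by rewrite !modnMDl !modn_small.
Qed.

Lemma grid_rank_lt i x y : (gc x i < gc y i)%N -> (grid_rank i x < grid_rank i y)%N.
Proof.
move=> xy; rewrite /grid_rank; apply: (@leq_trans ((gc x i).+1 * #|{: grid}|)).
  by rewrite mulSn addnC ltn_add2r.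
by apply: leq_trans (leq_addr _ _); rewrite leq_mul2r xy orbT.
Qed.

Lemma grid_rank_le i x y : (grid_rank i x <= grid_rank i y)%N -> (gc x i <= gc y i)%N.
Proof. by rewrite leqNgt => xy; rewrite leqNgt; apply: contra xy; exact: grid_rank_lt. Qed.

(** If the least [i]-th coordinates, for [i] in [C], had a small sum, raising all
    of them by one would leave room for a grid point that contradicts dominance.
    As their sum is within [#|C|] of [M], the points of [s] differ little. *)
Lemma dominant_small (x0 : grid) (s : {set grid}) (C : {set 'I_k}) (x y : grid) j :
  dominant grid_rank s C -> C != finset.set0 -> C \subset V -> s != finset.set0 ->
  x \in s -> y \in s -> (gc x j <= gc y j + k)%N /\ (j \notin C -> (gc x j <= k)%N).
Proof.
move=> dom /finset.set0Pn[i1 i1C] /fintype.subsetP CV s0 xs ys.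
pose m i := gc (mn grid_rank x0 s i) i.
have mle i z : z \in s -> (m i <= gc z i)%N.
  by move=> zs; have [_ mmin] := mnP grid_rank x0 i s0; exact/grid_rank_le/mmin.
(* The remainder of the coordinate sum is put on an arbitrary index of C. *)
have big : (M < \sum_(i in C) (m i).+1)%N.
  rewrite ltnNge; apply/negP => small.
  pose z i := ((if i \in C then (m i).+1 else 0) +
    (if i == i1 then M - \sum_(i in C) (m i).+1 else 0))%N.
  have [|j' j'V|g gE] := @grid_ex z.
  - rewrite big_split /= -big_mkcond -[X in (_ + X)%N]big_mkcond /= big_pred1_eq.
    by rewrite subnKC.
  - rewrite /z ifN; last by apply: contra j'V => /CV.
    rewrite ifN //; apply: contraNneq j'V => ->; exact: CV.
  have /dominantP/(_ g)[i iC] := dom.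
  rewrite (aboveE _ x0) // => /negP[]; apply: grid_rank_lt.
  by rewrite gE /z iC -/(m i) ltnS leq_addr.
have sumC z : (\sum_(i in C) gc z i <= M)%N.
  rewrite -(grid_sum z) [X in (_ <= X)%N](bigID [in C]) /=; exact: leq_addr.
have cardC : (#|C| <= k)%N by rewrite -[k in X in (_ <= X)%N]card_ord max_card.
have bigm : (M < \sum_(i in C) m i + #|C|)%N.
  apply: leq_trans big _; under eq_bigr do rewrite -addn1.
  by rewrite big_split /= sum1_card.
have le_m z : z \in s -> (\sum_(i in C) m i <= \sum_(i in C) gc z i)%N.
  by move=> zs; apply: leq_sum => i _; exact: mle.
have out z : z \in s -> j \notin C -> (gc z j <= k)%N.
  move=> zs jC; have := grid_sum z; rewrite (bigID [in C]) /= (bigD1 j jC) /=.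
  move: cardC bigm (le_m z zs).
  move: (\sum_(i in C) m i)%N (\sum_(i in C) gc z i)%N #|C| => a b c.
  lia.
split; last exact: out.
have [jC|jC] := boolP (j \in C); last by have := out x xs jC; lia.
have sub : (\sum_(i in C | i != j) m i <= \sum_(i in C | i != j) gc x i)%N.
  by apply: leq_sum => i _; exact: mle.
have := sumC x; rewrite (bigD1 j jC) /=; move: bigm; rewrite (bigD1 j jC) /=.
move: sub cardC (mle j y ys).
move: (\sum_(i in C | i != j) m i)%N (\sum_(i in C | i != j) gc x i)%N (m j) #|C| => a b c d.
lia.
Qed.

End Grid.

Section Brouwer.
Variables (R : realType) (k : nat).
Implicit Types (V : {set 'I_k}) (x y : 'rV[R]_k).

Definition simplex V : set 'rV[R]_k :=
  [set x : 'rV[R]_k | [/\ forall j, 0 <= x 0 j, \sum_j x 0 j = 1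
     & forall j, j \notin V -> x 0 j = 0]]%classic.

Lemma nbhs_rowP (x : 'rV[R]_k) (A : set 'rV[R]_k) :
  nbhs x A -> exists2 e : R, 0 < e & forall y, (forall j, `|x 0 j - y 0 j| < e) -> A y.
Proof.
move=> /nbhs_ballP[e /= e0 H]; exists e => // y Hy; apply: H; split=> // i j.
rewrite (ord1 i); exact: Hy.
Qed.

Lemma coord_cont j : continuous (fun x : 'rV[R]_k => x 0 j).
Proof. exact: coord_continuous. Qed.

Lemma sum_coord_cont : continuous (fun x : 'rV[R]_k => \sum_j x 0 j).
Proof. by apply: continuous_sum => j _; exact: coord_cont. Qed.

Lemma simplex_compact V : compact (simplex V).
Proof.
have cube := @rV_compact R k (fun=> `[0, 1]%classic) (fun=> @segment_compact R 0 1).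
apply: subclosed_compact cube _ => [|x [x0 x1 _] j]; last first.
  rewrite /= in_itv /= x0 -x1 (bigD1 j) //= lerDl; apply: sumr_ge0 => i _; exact: x0.
have -> : simplex V = (((\bigcap_j [set x : 'rV[R]_k | 0 <= x 0 j]) `&`
   [set x : 'rV[R]_k | \sum_j x 0 j = 1]) `&`
   \bigcap_(j in [set j | j \notin V]) [set x : 'rV[R]_k | x 0 j = 0])%classic.
  apply/seteqP; split=> x /=.
    by move=> [x0 x1 xV]; split=> [|j]; [split=> // j _; exact: x0 | exact: xV].
  by move=> [[x0 x1] xV]; split=> // j; exact: x0.
apply: closedI; first apply: closedI.
- apply: closed_bigI => j _.
  have := (continuous_closedP _).1 (@coord_cont j) [set r : R | 0 <= r]%classic.
  by apply; exact: closed_ge.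
- have := (continuous_closedP _).1 sum_coord_cont [set r : R | r = 1]%classic.
  by apply; exact: closed_eq.
- apply: closed_bigI => j _.
  have := (continuous_closedP _).1 (@coord_cont j) [set r : R | r = 0]%classic.
  by apply; exact: closed_eq.
Qed.

(** Label a grid point [x] by some [i] with [x_i <= f(x)_i], which exists because
    the coordinate sums agree, and take a fully labelled room. *)
Lemma approx_fixpoint V (f : 'rV[R]_k -> 'rV[R]_k) n : V != finset.set0 ->
  (forall x, simplex V x -> simplex V (f x)) ->
  exists (x : 'rV[R]_k) (C : {set 'I_k}), [/\ simplex V x,
    forall i, i \in C -> exists y, [/\ simplex V y, y 0 i <= f y 0 i
      & forall j, `|x 0 j - y 0 j| <= k%:R / n.+1%:R]
    & forall i, i \notin C -> x 0 i <= k%:R / n.+1%:R].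
Proof.
move=> V0 fV.
pose pt (g : grid n.+1 V) : 'rV[R]_k := \row_j ((gc g j)%:R / n.+1%:R).
have ptV g : simplex V (pt g).
  split=> [j||j jV]; first by rewrite mxE divr_ge0.
    under eq_bigr do rewrite mxE.
    by rewrite -mulr_suml -natr_sum grid_sum divff // pnatr_eq0.
  by rewrite mxE grid_out // mul0r.
have lab g : exists i, i \in V /\ pt g 0 i <= f (pt g) 0 i.
  have [_ s1 out1] := ptV g; have [_ s2 out2] := fV _ (ptV g).
  suff : exists2 i, i \in V & pt g 0 i <= f (pt g) 0 i by move=> [i]; exists i.
  apply/exists_inP; apply: contraT; rewrite negb_exists_in => /forall_inP H.
  have sumV (x : 'rV[R]_k) : (forall j, j \notin V -> x 0 j = 0) ->
      \sum_(j in V) x 0 j = \sum_j x 0 j.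
    by move=> out; rewrite [RHS](bigID [in V]) /= [X in _ + X]big1 ?addr0.
  suff : \sum_(j in V) f (pt g) 0 j < \sum_(j in V) pt g 0 j.
    by rewrite !sumV // s1 s2 ltxx.
  apply: ltr_sum => [|i /H]; last by rewrite -ltNge.
  by have [i iV] := finset.set0Pn _ V0; apply/hasP; exists i => //; exact: mem_index_enum.
have [c cP] := choice lab.
have [i0 i0V] := finset.set0Pn _ V0.
have [g0 _] : exists g : grid n.+1 V, forall j, gc g j = if j == i0 then n.+1 else 0%N.
  apply: grid_ex => [|j]; first by rewrite -big_mkcond big_pred1_eq.
  by apply: contraNeq; have [->|] := eqVneq j i0.
have [s [C [cardC dom C0 cs]]] := scarf g0 (@grid_rank_inj k n.+1 V) c i0.
have CV : C \subset V.
  by rewrite -cs; apply/fintype.subsetP => _ /imsetP[g _ ->]; case: (cP g).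
have s0 : s != finset.set0 by apply: contraNneq C0 => s0; rewrite -cs s0 imset0.
have [g gs] := finset.set0Pn _ s0.
have n0 : 0 < n.+1%:R :> R by rewrite ltr0n.
exists (pt g), C; split=> // [i|i iC].
  rewrite -cs => /imsetP[h hs ->]; exists (pt h); split=> //; first by case: (cP h).
  move=> j; rewrite !mxE -mulrBl normrM normfV (ger0_norm (ltW n0)).
  rewrite ler_pM2r ?invr_gt0 // ler_norml lerBlDl lerNl opprB lerBlDl -!natrD !ler_nat.
  have [gh _] := dominant_small V0 g0 j dom C0 CV s0 gs hs.
  have [hg _] := dominant_small V0 g0 j dom C0 CV s0 hs gs.
  by rewrite hg gh.
have [_ /(_ iC) gk] := dominant_small V0 g0 i dom C0 CV s0 gs gs.
by rewrite mxE ler_pM2r ?invr_gt0 // ler_nat.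
Qed.

(** Let [p] be a cluster point of approximate fixed points. If [f p] differs from
    [p], then [f(p)_i < p_i] for some [i], and by continuity [f(y)_i] stays below
    the [i]-th coordinate for all [y] near [p]. The approximations contradict
    this: for [i] in [C] there are points [y] near [p] with [y_i <= f(y)_i], and
    for [i] outside [C] the [i]-th coordinate of [p] would be [0]. *)
Theorem brouwer V (f : 'rV[R]_k -> 'rV[R]_k) : V != finset.set0 ->
  {within simplex V, continuous f}%classic ->
  (forall x, simplex V x -> simplex V (f x)) ->
  exists2 x, simplex V x & f x = x.
Proof.
move=> V0 /subspace_continuousP cf fV.
have [x_ xP] := choice (fun n => approx_fixpoint n V0 fV).
have [] := @simplex_compact V (x_ @ \oo)%classic _ _.
  by exists 0%N => // n _; have [C []] := xP n.
move=> p [pV pcl]; exists p => //.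
apply: contrapT => fpp; have [i fi] : exists i, f p 0 i < p 0 i.
  apply: contrapT => /forallNP H; apply: fpp.
  have le i : p 0 i <= f p 0 i by rewrite leNgt; apply/negP/H.
  have [_ s1 _] := pV; have [_ s2 _] := fV _ pV.
  have : \sum_i (f p 0 i - p 0 i) == 0 by rewrite sumrB s1 s2 subrr.
  rewrite psumr_eq0 => [/allP eq0|i _]; last by rewrite subr_ge0.
  apply/rowP => i; have := eq0 i (mem_index_enum _).
  by rewrite subr_eq0 => /eqP.
clear fpp; pose mid := (f p 0 i + p 0 i) / 2.
have fm : f p 0 i < mid by rewrite /mid; lra.
have mp : mid < p 0 i by rewrite /mid; lra.
have m0 : 0 <= mid by have [f0 _ _] := fV _ pV; rewrite (le_trans (f0 i)) ?ltW.
have nb : nbhs (f p 0 i) [set r : R | r < mid]%classic.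
  by apply: open_nbhs_nbhs; split=> //; exact: open_lt.
have := cf p pV _ (@coord_cont i (f p) _ nb).
move=> /nbhs_rowP[e e0 He].
pose d := Num.min e (p 0 i - mid).
have d0 : 0 < d by rewrite lt_min e0 subr_gt0.
have [N Nd] : exists N : nat, k%:R / N.+1%:R < d / 2.
  have /ltr_add_invr[N] : 0 < d / (2 * k.+1%:R).
    by rewrite divr_gt0 // mulr_gt0 // ltr0n.
  rewrite add0r => HN; exists N.
  have k0 : 0 < k.+1%:R :> R by rewrite ltr0n.
  apply: le_lt_trans (_ : k.+1%:R / N.+1%:R < _).
    by rewrite ler_pM2r ?invr_gt0 ?ltr0n // ler_nat.
  rewrite -ltr_pdivlMl //; apply: lt_le_trans HN _.
  by rewrite invfM mulrA mulrC.
have [] := pcl (x_ @` [set n | (N <= n)%N])%classic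
  [set y | forall j, `|p 0 j - y 0 j| < d / 2]%classic.
- by exists N => // n Nn; exists n.
- have := @nbhsx_ballx _ _ p (d / 2); rewrite divr_gt0 // => /(_ isT).
  by apply: filterS => y [_ Hy] j; exact: Hy.
move=> _ [[n /= Nn <-] xnear].
have [C [xV lab out]] := xP n.
have nd : k%:R / n.+1%:R < d / 2.
  by apply: le_lt_trans Nd; rewrite ler_wpM2l // lef_pV2 ?posrE ?ltr0n // ler_nat.
have de : d <= e by rewrite ge_min lexx.
have dp : d <= p 0 i - mid by rewrite ge_min lexx orbT.
have [iC|iC] := boolP (i \in C); last first.
  have := le_lt_trans (out i iC) nd; have := xnear i.
  by rewrite ltr_norml => /andP[_ H1] H2; clear - H1 H2 dp m0; lra.
have [y [yV yf xy]] := lab i iC.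
have pyd j : `|p 0 j - y 0 j| < d.
  have -> : p 0 j - y 0 j = (p 0 j - x_ n 0 j) + (x_ n 0 j - y 0 j) by ring.
  apply: le_lt_trans (ler_normD _ _) _.
  have := ltrD (xnear j) (le_lt_trans (xy j) nd).
  by rewrite -[d / 2 + d / 2]splitr.
have fy : f y 0 i < mid by apply: He => // j; exact: lt_le_trans (pyd j) de.
by have := pyd i; rewrite ltr_norml => /andP[_ H]; lra.
Qed.

End Brouwer.

(** * Collapses, retractions of a simplex, and spheres *)

Lemma within_comp (X Y Z : topologicalType) (A : set X) (B : set Y)
    (f : X -> Y) (g : Y -> Z) :
  (forall x, A x -> B (f x)) ->
  {within A, continuous f}%classic -> {within B, continuous g}%classic ->
  {within A, continuous (g \o f)}%classic.
Proof.
move=> AB /subspace_continuousP cf /subspace_continuousP cg.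
apply/subspace_continuousP => x Ax U nU.
have H := cf x Ax _ (cg (f x) (AB x Ax) U nU).
change (nbhs x [set y | A y -> B (f y) -> U (g (f y))]%classic) in H.
change (nbhs x [set y | A y -> U (g (f y))]%classic).
by apply: filterS H => y H Ay; exact: H Ay (AB y Ay).
Qed.

Lemma cvg_row (R : realType) (X : Type) (F : set_system X) (FF : Filter F) k
    (f : X -> 'rV[R]_k) (l : 'rV[R]_k) :
  (forall j, f x 0 j @[x --> F] --> l 0 j)%classic -> (f @ F --> l)%classic.
Proof.
move=> H A [P Pl PA].
have : F (\bigcap_(j in [set: 'I_k]) (fun x => f x 0 j) @^-1` (P 0 j))%classic.
  have -> : [set: 'I_k]%classic = [set j | j \in index_enum 'I_k]%classic.
    by apply/seteqP; split=> // j _; exact: mem_index_enum.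
  elim: (index_enum 'I_k) => [|j s IHs].
    by apply: filterS filterT => x _ j.
  have Pj : F ((fun x => f x 0 j) @^-1` (P 0 j))%classic by exact/H/Pl.
  apply: filterS (filterI Pj IHs) => x [xj xs] i /=.
  by rewrite inE => /orP[/eqP ->//|]; exact: xs.
move=> HF; change (F (f @^-1` A)%classic).
by apply: filterS HF => x Hx; apply: PA => i j; rewrite (ord1 i); exact: Hx.
Qed.

Section Collapse.
Variables (R : realType) (T : finType).
Local Notation rV := 'rV[R]_#|T|.
Implicit Types (D E : {set {set T}}) (F G : {set T}) (x y : rV).

Definition crd x (t : T) : R := x 0 (enum_rank t).

Definition supp x : {set T} := [set t | crd x t != 0]%SET.

Definition down_closed D := forall F G, G \in D -> F \subset G -> F \in D.

Lemma crd_sum x : \sum_t crd x t = \sum_j x 0 j.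
Proof.
rewrite [RHS](reindex (@enum_rank T)) //.
by exists (@enum_val T predT) => j _; [exact: enum_rankK | exact: enum_valK].
Qed.

Lemma realizationP D x : realization D x <->
  [/\ forall t, 0 <= crd x t, \sum_t crd x t = 1 & supp x \in D].
Proof.
rewrite crd_sum; split=> [[x0 x1 xD]|[x0 x1 xD]]; split=> //.
  by move=> t; exact: x0.
by move=> j; rewrite -(enum_valK j); exact: x0.
Qed.

Definition retract_onto D E : Prop := exists r : rV -> rV,
  [/\ continuous r, forall x, realization D x -> realization E (r x)
    & forall x, realization E x -> r x = x].

Lemma retract_onto_refl D : retract_onto D D.
Proof. by exists idfun; split=> // x; exact: cvg_id. Qed.

Lemma realization_sub D E : E \subset D -> forall x, realization (R := R) E x -> realization D x.
Proof. by move=> /fintype.subsetP ED x /realizationP[x0 x1 /ED xE]; apply/realizationP. Qed.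

Lemma retract_onto_trans D E D' : D' \subset E ->
  retract_onto D E -> retract_onto E D' -> retract_onto D D'.
Proof.
move=> sub [r1 [c1 m1 f1]] [r2 [c2 m2 f2]]; exists (r2 \o r1); split.
- by move=> x; apply: continuous_comp; [exact: c1 | exact: c2].
- by move=> x /m1 /m2.
- by move=> x xD; rewrite /= f1 ?f2 //; exact: (realization_sub sub).
Qed.

Lemma crd_cont t : continuous (crd^~ t).
Proof. exact: coord_cont. Qed.

(** The default value [1] is harmless, as barycentric coordinates are at most
    [1]. *)
Definition low F x : R := \big[Num.min/1]_(t in F) crd x t.

Lemma low_cont F : continuous (low F).
Proof. by apply: continuous_bigmin => t _; exact: crd_cont. Qed.

Lemma low_le F x t : t \in F -> low F x <= crd x t.
Proof. by move=> tF; apply: bigmin_le_cond. Qed.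

Lemma low_attained F x : F != finset.set0 -> (forall t, crd x t <= 1) ->
  exists2 t, t \in F & low F x = crd x t.
Proof.
move=> /finset.set0Pn[t0 t0F] x1.
case: (@arg_minP _ _ _ t0 [in F] (crd x) t0F) => t tF tmin; exists t => //.
by apply/eqP; rewrite eq_le low_le //=; apply/bigmin_geP; split.
Qed.

(** The elementary collapse at the free face [F] of [v |: F]: mass moves from the
    vertices of [F] to [v] until one of them has none left. The formula makes
    sense everywhere, and points whose support does not contain [F] stay put. *)
Definition push F v x : rV :=
  \row_j (x 0 j + low F x * (#|F|%:R *+ (enum_val j == v) - 1 *+ (enum_val j \in F))).

Lemma crd_push F v x t :
  crd (push F v x) t = crd x t + low F x * (#|F|%:R *+ (t == v) - 1 *+ (t \in F)).
Proof. by rewrite /crd mxE enum_rankK. Qed.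

Lemma push_cont F v : continuous (push F v).
Proof.
move=> x; have FF : Filter (nbhs x) by exact: nbhs_filter.
apply: (cvg_row FF) => j; rewrite mxE; under eq_fun do rewrite mxE.
apply: cvgD; first exact: coord_cont.
by apply: cvgM; [exact: low_cont | exact: cvg_cst].
Qed.

Lemma retract_collapse D F v :
  down_closed D -> F != finset.set0 -> v \notin F -> v |: F \in D ->
  (forall G, G \in D -> F \subset G -> G = F \/ G = v |: F) ->
  retract_onto D (D :\: [set F; v |: F])%SET.
Proof.
move=> dD F0 vF vFD free; exists (push F v); split.
- exact: push_cont.
- move=> x /realizationP[x0 x1 xD].
  have xle t : crd x t <= 1.
    by rewrite -x1 (bigD1 t) //= lerDl sumr_ge0.
  have low0 : 0 <= low F x.
    by have [t _ ->] := low_attained F0 xle; exact: x0.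
  have [Fx|Fx] := boolP (F \subset supp x); last first.
    have low_0 : low F x = 0.
      move: Fx => /fintype.subsetPn[t tF]; rewrite inE negbK => /eqP xt.
      by apply/eqP; rewrite eq_le low0 -{1}xt low_le.
    have -> : push F v x = x by apply/rowP => j; rewrite mxE low_0 mul0r addr0.
    apply/realizationP; split=> //; rewrite finset.in_setD xD andbT.
    by apply: contra Fx; rewrite !inE => /orP[] /eqP ->; rewrite ?subxx ?finset.subsetUr.
  have sx : supp x \subset v |: F.
    by case: (free _ xD Fx) => ->; rewrite ?subxx ?finset.subsetUr.
  have [t tF tlow] := low_attained F0 xle.
  have low_gt0 : 0 < low F x.
    by rewrite lt_def low0 andbT tlow; move/fintype.subsetP: Fx => /(_ t tF); rewrite inE.
  have pushF s : s \in F -> crd (push F v x) s = crd x s - low F x.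
    move=> sF; rewrite crd_push sF (_ : (s == v) = false) ?mulr0n ?sub0r ?mulr1n ?mulrN1 //.
    by apply: contraNF vF => /eqP <-.
  have pushv : crd (push F v x) v = crd x v + low F x * #|F|%:R.
    by rewrite crd_push eqxx (negbTE vF) mulr0n mulr1n subr0.
  have pushN s : s != v -> s \notin F -> crd (push F v x) s = crd x s.
    by move=> /negbTE sv /negbTE sF; rewrite crd_push sv sF subrr mulr0 addr0.
  apply/realizationP; split.
  + move=> s; have [sF|sF] := boolP (s \in F); first by rewrite pushF // subr_ge0 low_le.
    have [->|sv] := eqVneq s v; first by rewrite pushv addr_ge0 // mulr_ge0.
    by rewrite pushN.
  + under eq_bigr do rewrite crd_push.
    rewrite big_split /= x1 -mulr_sumr sumrB (bigD1 v) //= eqxx mulr1n.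
    rewrite big1 => [|s /negbTE ->]; last by rewrite mulr0n.
    rewrite (_ : \sum_s 1 *+ (s \in F) = #|F|%:R) ?addr0 ?subrr ?mulr0 ?addr0 //.
    by rewrite -sumr_const [RHS]big_mkcond; apply: eq_bigr => s _; case: ifP.
  + have sp : supp (push F v x) \subset v |: F.
      apply/fintype.subsetP => s; rewrite !inE => sn0; apply: contraNT sn0.
      rewrite negb_or => /andP[sv sF]; rewrite pushN //.
      have : s \notin supp x by apply: contra (sF) => /(fintype.subsetP sx); rewrite !inE (negbTE sv).
      by rewrite inE negbK.
    have tp : t \notin supp (push F v x) by rewrite inE pushF // tlow subrr eqxx.
    rewrite finset.in_setD (dD _ _ vFD sp) andbT !inE negb_or.
    have tG G : F \subset G -> supp (push F v x) != G.
      by move=> /fintype.subsetP FG; apply: contraNneq tp => ->; exact: FG.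
    by rewrite !tG ?subxx ?finset.subsetUr.
- move=> x /realizationP[x0 _ xE].
  suff low_0 : low F x = 0 by apply/rowP => j; rewrite mxE low_0 mul0r addr0.
  move: xE; rewrite finset.in_setD => /andP[nx xD].
  have /fintype.subsetPn[t tF] : ~~ (F \subset supp x).
    by apply: contra nx => /(free _ xD)[] ->; rewrite !inE eqxx ?orbT.
  rewrite inE negbK => /eqP xt; apply/eqP; rewrite eq_le -{1}xt low_le //=.
  by apply/bigmin_geP; split.
Qed.

Definition toggle (t : T) F := if t \in F then F :\ t else t |: F.

Lemma toggleK t F : toggle t (toggle t F) = F.
Proof.
rewrite /toggle; have [tF|tF] := boolP (t \in F).
  by rewrite setD11 finset.setD1K.
by rewrite finset.setU11 finset.setU1K.
Qed.

(** Pair every set [F] that is to be removed with the set obtained by toggling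
    the vertex [tau F]. Along inclusions [kappa] does not decrease, and [tau] only
    changes when [kappa] grows. Hence, if the pairs are removed by decreasing
    [kappa] and, for equal [kappa], by decreasing size, then at its turn the
    smaller set of a pair has no coface besides the larger one. *)
Lemma retract_patchwork D0 D (kappa : {set T} -> nat) (tau : {set T} -> T) :
  down_closed D0 -> down_closed D -> D \subset D0 -> finset.set0 \in D ->
  (forall F, F \in D0 :\: D -> [/\ toggle (tau F) F \in D0 :\: D,
     kappa (toggle (tau F) F) = kappa F & tau (toggle (tau F) F) = tau F]) ->
  (forall F G, F \in D0 :\: D -> G \in D0 :\: D -> F \subset G ->
     (kappa F <= kappa G)%N /\ (kappa F = kappa G -> tau F = tau G)) ->
  retract_onto D0 D.
Proof.
move=> dD0 dD DD0 D_0 tog mono.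
suff H n E : (#|E :\: D| < n)%N -> down_closed E -> D \subset E -> E \subset D0 ->
    (forall F, F \in E :\: D -> toggle (tau F) F \in E :\: D) -> retract_onto E D.
  by apply: (H _ D0 (leqnn _)) => // F /tog[].
elim: n E => // n IHn E ltn dE DE ED0 togE.
have EDS : E :\: D \subset D0 :\: D by exact: finset.setSD.
have [ED|[F0 F0ED]] := finset.set_0Vmem (E :\: D).
  have -> : E = D by apply/eqP; rewrite finset.eqEsubset DE -finset.setD_eq0 ED eqxx.
  exact: retract_onto_refl.
(* The lexicographic order on kappa and the size of the larger set of the pair. *)
pose w F := (kappa F * #|T|.+1 + #|tau F |: F|)%N.
have wlt F G : (kappa F < kappa G)%N -> (w F < w G)%N.
  move=> lt; apply: (@leq_trans ((kappa F).+1 * #|T|.+1)).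
    by rewrite mulSn [X in (_ < X)%N]addnC ltn_add2l ltnS max_card.
  by apply: leq_trans (leq_addr _ _); rewrite leq_mul2r lt orbT.
have [F [FED Fmax tF]] : exists F, [/\ F \in E :\: D,
    forall G, G \in E :\: D -> (w G <= w F)%N & tau F \notin F].
  case: (@arg_maxnP _ F0 (fun F => F \in E :\: D) w F0ED) => F FED Fmax.
  have [tF|tF] := boolP (tau F \in F); last by exists F.
  have [_ kF tauF] := tog F (fintype.subsetP EDS _ FED).
  have := togE F FED; rewrite /toggle tF => F'ED; exists (F :\ tau F).
  move: kF tauF; rewrite /toggle tF => kF tauF; split=> //.
    move=> G GED; rewrite /w kF tauF finset.setD1K //.
    have -> : #|F| = #|tau F |: F| by rewrite (finset.setUidPr _) // finset.sub1set.
    exact: Fmax.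
  by rewrite tauF setD11.
have FD := FED; rewrite finset.in_setD in FD; have [nFD FE] := andP FD.
have F0' : F != finset.set0 by apply: contraNneq nFD => ->.
have FvED : tau F |: F \in E :\: D by have := togE F FED; rewrite /toggle (negbTE tF).
have [nFvD FvE] : tau F |: F \notin D /\ tau F |: F \in E.
  by move: FvED; rewrite finset.in_setD => /andP[].
have free G : G \in E -> F \subset G -> G = F \/ G = tau F |: F.
  move=> GE FG; have GED : G \in E :\: D.
    by rewrite finset.in_setD GE andbT; apply: contra nFD => /dD; exact.
  have [kle keq] := mono F G (fintype.subsetP EDS _ FED) (fintype.subsetP EDS _ GED) FG.
  have {}keq : kappa F = kappa G.
    apply/eqP; rewrite eqn_leq kle leqNgt; apply/negP => /wlt.
    by rewrite ltnNge Fmax.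
  have tE := mono F G (fintype.subsetP EDS _ FED) (fintype.subsetP EDS _ GED) FG.
  have {}tE := tE.2 keq.
  have : tau F |: F == tau F |: G.
    rewrite eqEcard finset.setUS //= -(leq_add2l (kappa F * #|T|.+1)).
    by have := Fmax G GED; rewrite /w -keq -tE.
  move=> /eqP UE; have [tG|tG] := boolP (tau F \in G).
    by right; rewrite UE; apply/esym/finset.setUidPr; rewrite finset.sub1set.
  by left; rewrite -(finset.setU1K tG) -UE finset.setU1K.
have subE : (E :\: [set F; tau F |: F])%SET \subset E by exact: finset.subsetDl.
have DE' : D \subset (E :\: [set F; tau F |: F])%SET.
  apply/fintype.subsetP => G GD; rewrite finset.in_setD (fintype.subsetP DE _ GD) andbT.
  by rewrite !inE negb_or; apply/andP; split; apply: contraTneq GD => ->.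
apply: (retract_onto_trans DE' (retract_collapse dE F0' tF FvE free)).
apply: IHn => //.
- rewrite -ltnS; apply: leq_trans ltn; rewrite ltnS; apply: proper_card; apply/properP; split.
    exact: finset.setSD.
  by exists F => //; rewrite !inE eqxx andbF.
- move=> G H; rewrite !finset.in_setD => /andP[nH HE] GH; rewrite (dE _ _ HE GH) andbT.
  have FH : F \subset H -> False.
    by move=> /(free _ HE)[] HE'; move: nH; rewrite HE' !inE eqxx ?orbT.
  rewrite !inE negb_or; apply/andP; split; apply/eqP => GE; apply: FH.
    by rewrite -GE.
  by apply: fintype.subset_trans GH; rewrite GE finset.subsetUr.
- exact: fintype.subset_trans subE ED0.
- move=> G; rewrite !finset.in_setD => /and3P[nGD nG GE].
  have GED : G \in E :\: D by rewrite finset.in_setD nGD GE.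
  have [_ _ tauG] := tog G (fintype.subsetP EDS _ GED).
  have := togE G GED; rewrite finset.in_setD => /andP[-> ->]; rewrite andbT /=.
  have tF' : toggle (tau F) F = tau F |: F by rewrite /toggle (negbTE tF).
  have [_ _ tauFv] := tog F (fintype.subsetP EDS _ FED).
  apply: contra nG; rewrite !inE => /orP[] /eqP GE'.
    by rewrite -(toggleK (tau G) G) GE' -tauG GE' tF' eqxx orbT.
  rewrite -(toggleK (tau G) G) GE' -tauG GE' -tF' tauFv toggleK eqxx //.
Qed.

(** Brouwer's theorem is applied to the retraction followed by [g]; a fixed point
    lies in the retract, where the retraction is the identity. *)
Lemma fpp_retract (V : {set T}) D : V != finset.set0 -> down_closed D ->
  D \subset finset.powerset V -> retract_onto (finset.powerset V) D ->
  forall g : rV -> rV, {within realization D, continuous g}%classic ->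
  (forall x, realization D x -> realization D (g x)) ->
  exists2 x, realization D x & g x = x.
Proof.
move=> V0 dD DV [r [cr rV rD]] g cg gD.
pose V' := [set enum_rank t | t in V]%SET.
have simplexE x : simplex V' x <-> realization (finset.powerset V) x.
  split=> [[x0 x1 xV]|[x0 x1 xV]]; split=> //.
    rewrite finset.powersetE; apply/fintype.subsetP => t; rewrite inE; apply: contraNT => tV.
    apply/eqP/xV; apply: contra tV => /imsetP[s sV /enum_rank_inj ->] //.
  move=> j jV; move: xV; rewrite finset.powersetE => /fintype.subsetP/(_ (enum_val j)).
  rewrite inE enum_valK; case: eqP => //= _ /(_ isT) jV'.
  by case/negP: jV; rewrite -(enum_valK j); exact: imset_f.
have [|||x xS gx] := @brouwer R #|T| V' (g \o r).
- by have [t tV] := finset.set0Pn _ V0; apply/finset.set0Pn; exists (enum_rank t); exact: imset_f.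
- apply: (within_comp (B := realization D)) cg => [x /simplexE/rV //|].
  exact: continuous_subspaceT.
- by move=> x /simplexE/rV/gD xD; apply/simplexE; exact: (realization_sub DV).
have xD : realization D x by rewrite -gx; apply/gD/rV/simplexE.
by exists x => //; rewrite -{2}gx /= rD.
Qed.

(** On a sphere the antipodal map has no fixed point; for the empty sphere this
    says that a retract of a simplex is not empty. *)
Lemma not_sphere (V : {set T}) D : V != finset.set0 -> down_closed D ->
  D \subset finset.powerset V -> retract_onto (finset.powerset V) D ->
  ~ simplicial_sphere R D.
Proof.
move=> V0 dD DV rD [k [h [g [ch cg hg gh]]]].
have neg_sphere (v : 'rV[R]_k) : unit_sphere v -> unit_sphere (- v).
  by rewrite /unit_sphere /= => <-; congr Num.sqrt; apply: eq_bigr => j _; rewrite mxE sqrrN.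
have [|x xD|x xD] := @fpp_retract V D V0 dD DV rD (g \o (-%R \o h)).
- apply: (within_comp (B := @unit_sphere R k)) cg => [x /hg[hx _]|]; first exact: neg_sphere.
  apply: (within_comp (B := @unit_sphere R k)) ch _ => [x /hg[] //|].
  apply: continuous_subspaceT; exact: opp_continuous.
- by have [/neg_sphere/gh[]] := hg x xD.
move=> /= gx; have [hx gh'] := hg x xD.
have [_ hN] := gh _ (neg_sphere _ hx); rewrite gx in hN.
have : unit_sphere (0 : 'rV[R]_k).
  suff <- : h x = 0 by [].
  apply/rowP => j; have := congr1 (fun v : 'rV[R]_k => v 0 j) hN; rewrite !mxE => H.
  lra.
rewrite /unit_sphere /= big1 ?sqrtr0 => [/eqP|j _]; first by rewrite eq_sym oner_eq0.
by rewrite mxE expr0n.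
Qed.

End Collapse.

(** * Projective dimension by syzygies *)

Section Kernel.
Variables (R : pzRingType) (M N : lmodType R) (g : {linear M -> N}).

Definition kernel_pred : {pred M} := fun x => g x == 0.

Fact kernel_submod_closed : submod_closed kernel_pred.
Proof.
split=> [|a x y]; rewrite !unfold_in ?linear0 // => /eqP gx /eqP gy.
by rewrite linearP gx gy scaler0 addr0.
Qed.

HB.instance Definition _ :=
  GRing.isSubmodClosed.Build R M kernel_pred kernel_submod_closed.

Record kernel := KernelElt { kernel_val : M; _ : kernel_val \in kernel_pred }.

HB.instance Definition _ := [isSub for kernel_val].
HB.instance Definition _ := [Choice of kernel by <:].
HB.instance Definition _ := [SubChoice_isSubLmodule of kernel by <:].

Lemma kernelP (x : kernel) : g (val x) = 0.
Proof. exact/eqP/(valP x). Qed.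

Lemma kernel_lift x : g x = 0 -> exists y : kernel, val y = x.
Proof. by move=> /eqP gx; exists (KernelElt gx). Qed.

End Kernel.

Section LinearMaps.
Variable R : pzRingType.
Implicit Types M N A B C Q : lmodType R.

Lemma linear_factor A M N (i : {linear A -> N}) (h : {linear M -> N}) :
  injective i -> (forall x, exists a, i a = h x) ->
  exists k : {linear M -> A}, forall x, i (k x) = h x.
Proof.
move=> inj_i /choice[k ik].
have k_lin : linear k by move=> a x y; apply: inj_i; rewrite !(ik, linearP).
pose kM := GRing.isLinear.Build R M A _ k k_lin.
pose kL : {linear M -> A} := HB.pack k kM.
by exists kL.
Qed.

Definition pair_map A B C (f : {linear A -> C}) (g : {linear B -> C}) (x : A * B) :=
  f x.1 + g x.2.

Fact pair_map_linear A B C (f : {linear A -> C}) (g : {linear B -> C}) :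
  linear (pair_map f g).
Proof.
by move=> a [x1 x2] [y1 y2]; rewrite /= /pair_map /= !linearP scalerDr addrACA.
Qed.

HB.instance Definition _ A B C (f : {linear A -> C}) (g : {linear B -> C}) :=
  GRing.isLinear.Build R (A * B)%type C _ (pair_map f g) (pair_map_linear f g).

Definition inl_map A B (x : A) : A * B := (x, 0).
Fact inl_map_linear A B : linear (@inl_map A B).
Proof. by move=> a x y; rewrite /inl_map; congr (_, _); rewrite /= scaler0 addr0. Qed.
HB.instance Definition _ A B :=
  GRing.isLinear.Build R A (A * B)%type _ (@inl_map A B) (@inl_map_linear A B).

Definition inr_map A B (x : B) : A * B := (0, x).
Fact inr_map_linear A B : linear (@inr_map A B).
Proof. by move=> a x y; rewrite /inr_map; congr (_, _); rewrite /= scaler0 addr0. Qed.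
HB.instance Definition _ A B :=
  GRing.isLinear.Build R B (A * B)%type _ (@inr_map A B) (@inr_map_linear A B).

Definition short_exact A B C (i : {linear A -> B}) (g : {linear B -> C}) :=
  [/\ injective i, forall y, exists x, g x = y
    & forall x, g x = 0 <-> exists a, i a = x].

Lemma kernel_exact M N (g : {linear M -> N}) :
  (forall y, exists x, g x = y) -> short_exact (val : {linear kernel g -> M}) g.
Proof.
move=> surj_g; split=> [x y /val_inj //|//|x].
by split=> [/kernel_lift[a <-]|[a <-]]; [exists a | exact: kernelP].
Qed.

Lemma projective_prod A B :
  projective_module A -> projective_module B -> projective_module (A * B)%type.
Proof.
move=> pA pB M N g h surj_g.
have [k1 gk1] := pA M N g (h \o @inl_map A B) surj_g.
have [k2 gk2] := pB M N g (h \o @inr_map A B) surj_g.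
exists (pair_map k1 k2) => -[x y]; rewrite /= /pair_map /= linearD gk1 gk2 /= -linearD.
by congr (h _); rewrite /inl_map /inr_map; congr (_, _); rewrite ?addr0 ?add0r.
Qed.

Lemma projective_split A B C (i : {linear A -> B}) (g : {linear B -> C}) :
  short_exact i g -> projective_module C ->
  exists (s : {linear C -> B}) (r : {linear B -> A}),
    (forall c, g (s c) = c) /\ (forall b, i (r b) + s (g b) = b).
Proof.
move=> [inj_i surj_g ex] pC; have [s gs] := pC _ _ g idfun surj_g.
pose h : {linear B -> B} := idfun \- (s \o g).
have [r ir] : exists r : {linear B -> A}, forall b, i (r b) = h b.
  apply: linear_factor => // b; have [a ia] : exists a, i a = h b.
    by apply/ex; rewrite /h /= linearB /= gs subrr.
  by exists a.
by exists s, r; split=> // b; rewrite ir /h /= subrK.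
Qed.

Lemma projective_ext A B C (i : {linear A -> B}) (g : {linear B -> C}) :
  short_exact i g -> projective_module A -> projective_module C ->
  projective_module B.
Proof.
move=> ex pA pC M N q h surj_q.
have [s [r [gs irs]]] := projective_split ex pC.
have [k1 qk1] := pA M N q (h \o i) surj_q.
have [k2 qk2] := pC M N q (h \o s) surj_q.
exists ((k1 \o r) \+ (k2 \o g)) => b.
by rewrite /= linearD qk1 qk2 /= -linearD irs.
Qed.

Lemma projective_iso A B (f : {linear A -> B}) :
  injective f -> (forall y, exists x, f x = y) ->
  projective_module A -> projective_module B.
Proof.
move=> inj_f surj_f pA M N q h surj_q.
have [k qk] := pA M N q (h \o f) surj_q.
have [f' ff'] := linear_factor (h := idfun) inj_f surj_f.
by exists (k \o f') => x; rewrite /= qk /= ff'.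
Qed.

(** Bounding the projective dimension one syzygy at a time suits induction on the
    bound. *)
Fixpoint pdim_le d M : Prop :=
  if d isn't d'.+1 then projective_module M else
  exists (K Q : lmodType R) (i : {linear K -> Q}) (g : {linear Q -> M}),
    [/\ short_exact i g, projective_module Q & pdim_le d' K].

Lemma projective_zero M : (forall x : M, x = 0) -> projective_module M.
Proof.
move=> M0 A B g h _; exists \0 => x /=.
by rewrite (M0 x) !linear0.
Qed.

Lemma row0 (x : 'rV[R]_0) : x = 0.
Proof. by apply/matrixP => i []. Qed.

Lemma pdim_leS d M : pdim_le d M -> pdim_le d.+1 M.
Proof.
elim: d M => [|d IHd] M; last first.
  by move=> [K [Q [i [g [ex pQ /IHd pK]]]]]; exists K, Q, i, g.
move=> pM; exists 'rV[R]_0, M, \0, idfun; split=> //.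
  split=> [x y _|y|x]; first by rewrite (row0 x) (row0 y).
    by exists y.
  by split=> [/= ->|[a <-]//]; exists 0.
exact/projective_zero/row0.
Qed.

Lemma pdim_leW d e M : (d <= e)%N -> pdim_le d M -> pdim_le e M.
Proof.
by move=> /subnK <-; elim: (e - d)%N => // k IHk /IHk; rewrite addSn; exact: pdim_leS.
Qed.

(** Horseshoe lemma: the projective covers of the two ends combine to one of the
    middle term, and the three kernels are again in a short exact sequence. *)
Lemma pdim_le_ext d A B C (i : {linear A -> B}) (g : {linear B -> C}) :
  short_exact i g -> pdim_le d A -> pdim_le d C -> pdim_le d B.
Proof.
elim: d A B C i g => [|d IHd] A B C i g ex; first exact: projective_ext ex.
move=> [KA [QA [kA [gA [[injkA surjA exA] pQA pKA]]]]].
move=> [KC [QC [kC [gC [[injkC surjC exC] pQC pKC]]]]].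
case: ex => inj_i surj_g ex.
have [l gl] := pQC _ _ g gC surj_g.
pose G : {linear (QA * QC)%type -> B} := pair_map (i \o gA) l.
have surjG y : exists x, G x = y.
  have [c gc] := surjC (g y); have [a ia] : exists a, i a = y - l c.
    by apply/ex; rewrite linearB gl gc subrr.
  have [x gx] := surjA a; exists (x, c).
  by rewrite /G /= /pair_map /= gx ia subrK.
exists (kernel G), (QA * QC)%type, (val : {linear kernel G -> _}), G.
split; [exact: kernel_exact | exact: projective_prod |].
have inj_val : injective (val : {linear kernel G -> _}) by exact: val_inj.
have [jA jAE] : exists k : {linear KA -> kernel G},
    forall x, val (k x) = (@inl_map QA QC \o kA) x.
  apply: linear_factor => // x; apply: kernel_lift.
  rewrite /G /= /pair_map /= linear0 addr0.
  by rewrite (exA _).2 ?linear0 //; exists x.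
have [jC jCE] : exists k : {linear kernel G -> KC},
    forall x, kC (k x) = (snd \o (val : {linear kernel G -> _})) x.
  apply: linear_factor => // x; apply/exC => /=.
  have := kernelP x; rewrite /G /= /pair_map /= => /(congr1 g).
  by rewrite linearD gl linear0 (ex _).2 ?add0r //; exists (gA (val x).1).
apply: (IHd _ _ _ jA jC) pKA pKC; split.
- by move=> x y xy; apply: injkA; have := jAE x; rewrite xy jAE /= /inl_map => -[->].
- move=> c; have [a ia] : exists a, i a = l (kC c).
    by apply/ex; rewrite gl; apply/exC; exists c.
  have [x gx] := surjA a.
  have [y yE] : exists y : kernel G, val y = (- x, kC c).
    by apply: kernel_lift; rewrite /G /= /pair_map /= !linearN gx ia addNr.
  by exists y; apply: injkC; rewrite jCE /= yE.
- move=> x; split=> [jx0|[a <-]]; last by apply: injkC; rewrite jCE /= jAE linear0.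
  have x2 : (val x).2 = 0 by have := jCE x; rewrite jx0 linear0 /=.
  have : gA (val x).1 = 0.
    apply: inj_i; have := kernelP x.
    by rewrite /G /= /pair_map /= x2 !linear0 addr0.
  move=> /exA[a aE]; exists a; apply: val_inj; rewrite jAE /= /inl_map aE.
  by rewrite [RHS]surjective_pairing x2.
Qed.

(** If [Q] covers [B], the kernel of [Q -> C] is an extension of [A] by the kernel
    of [Q -> B], and the horseshoe lemma applies to it. *)
Lemma pdim_le_quo d A B C (i : {linear A -> B}) (g : {linear B -> C}) :
  short_exact i g -> pdim_le d A -> pdim_le d.+1 B -> pdim_le d.+1 C.
Proof.
move=> [inj_i surj_g ex] pA [K [Q [k [q [[injk surjq exq] pQ pK]]]]].
pose G : {linear Q -> C} := g \o q.
have surjG y : exists x, G x = y.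
  by have [b <-] := surj_g y; have [x <-] := surjq b; exists x.
exists (kernel G), Q, (val : {linear kernel G -> _}), G.
split=> //; first exact: kernel_exact.
have inj_val : injective (val : {linear kernel G -> _}) by exact: val_inj.
have [j jE] : exists j : {linear K -> kernel G}, forall x, val (j x) = k x.
  apply: linear_factor => // x; apply: kernel_lift => /=.
  by rewrite (exq _).2 ?linear0 //; exists x.
have [h hE] : exists h : {linear kernel G -> A},
    forall x, i (h x) = (q \o (val : {linear kernel G -> _})) x.
  by apply: linear_factor => // x; apply/ex; exact: kernelP x.
apply: (pdim_le_ext (i := j) (g := h)) => //; split.
- by move=> x y xy; apply: injk; rewrite -!jE xy.
- move=> a; have [x xE] := surjq (i a).
  have [y yE] : exists y : kernel G, val y = x.
    by apply: kernel_lift; rewrite /= xE; apply/ex; exists a.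
  by exists y; apply: inj_i; rewrite hE /= yE.
- move=> x; split=> [hx0|[a <-]].
    have /exq[a aE] : q (val x) = 0 by have := hE x; rewrite hx0 linear0 /=.
    by exists a; apply: val_inj; rewrite jE.
  by apply: inj_i; rewrite hE /= jE linear0; apply/exq; exists a.
Qed.

(** The terms of a resolution from the second one on resolve the kernel of the
    augmentation, and conversely. *)
Lemma proj_resolution_pdim_le d M : proj_resolution M d <-> pdim_le d M.
Proof.
elim: d M => [|d IHd] M; split.
- move=> [Q [aug [bd [pQ Q0 surj ex0 _]]]].
  apply: projective_iso (pQ 0%N); [|exact: surj].
  apply: raddf_inj => x /ex0[z <-]; by rewrite (Q0 1%N (ltnSn 0) z) linear0.
- move=> pM; pose Q i : lmodType R := if i is 0%N then M else 'rV[R]_0.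
  exists Q, (idfun : {linear Q 0%N -> M}), (fun i => \0 : {linear Q i.+1 -> Q i}).
  split=> //.
  + by case=> // i; exact/projective_zero/row0.
  + by case=> // i _ x; exact: row0.
  + by move=> y; exists y.
  + by move=> x; split=> [/= ->|[z <-]//]; exists 0.
  + by move=> i x; split=> [_|//]; exists 0; case: i x => [|i] x /=; rewrite ?(row0 x).
- move=> [Q [aug [bd [pQ Q0 surj ex0 ex]]]].
  exists (kernel aug), (Q 0%N), (val : {linear kernel aug -> _}), aug.
  split=> //; first exact: kernel_exact.
  have [h hE] : exists h : {linear Q 1%N -> kernel aug}, forall x, val (h x) = bd 0%N x.
    apply: linear_factor; first exact: val_inj.
    by move=> x; apply: kernel_lift; apply/ex0; exists x.
  apply/IHd; exists (fun i => Q i.+1), h, (fun i => bd i.+1); split=> //.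
  + by move=> i di; exact: Q0.
  + move=> y; have /ex0[z zE] := kernelP y.
    by exists z; apply: val_inj; rewrite hE.
  + move=> x; rewrite -(ex 0%N); split=> [h0|b0]; first by rewrite -hE h0 linear0.
    by apply: val_inj; rewrite hE b0.
- move=> [K [Q0 [k [g [[injk surjg exg] pQ0 /IHd]]]]].
  move=> [Q [aug [bd [pQ Qd surj ex0 ex]]]].
  pose Q' i : lmodType R := if i is i'.+1 then Q i' else Q0.
  pose bd' i : {linear Q' i.+1 -> Q' i} :=
    if i is i'.+1 then bd i' else (k \o aug : {linear Q 0%N -> Q0}).
  exists Q', (g : {linear Q' 0%N -> M}), bd'; split=> //.
  + by case.
  + by case=> // i; exact: Qd.
  + move=> x; rewrite exg; split=> [[a <-]|[z <-]]; last by exists (aug z).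
    by have [z <-] := surj a; exists z.
  + case=> [|i] x; last exact: ex.
    rewrite -ex0 /=; split=> [|->]; last exact: linear0.
    by rewrite -{1}[0](linear0 k) => /injk.
Qed.

Lemma pdim_le_pd_le d M : pdim_le d M -> pd_le M d.
Proof.
move=> /proj_resolution_pdim_le Md.
have ex : exists e, `[< proj_resolution M e >] by exists d; apply/asboolP.
exists (ex_minn ex); case: ex_minnP => e /asboolP Me mine.
  by apply: mine; apply/asboolP.
by split=> // e' Me'; apply: mine; apply/asboolP.
Qed.

End LinearMaps.

(** * Ideals of variables and linear quotients *)

Section Ideals.
Variable R : comNzRingType.
Implicit Types (G W : set R) (u c x : R).

Lemma ideal_gen G u : G u -> u \in ideal_of G.
Proof.
move=> Gu; apply/asboolP; exists [:: (1, u)]; rewrite big_seq1 mul1r.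
by split=> // y; rewrite inE => /eqP ->.
Qed.

Lemma idealD G x y : x \in ideal_of G -> y \in ideal_of G -> x + y \in ideal_of G.
Proof. exact: (@rpredD R^o (ideal_of G)). Qed.

Lemma idealN G x : x \in ideal_of G -> - x \in ideal_of G.
Proof. by rewrite (@rpredN R^o (ideal_of G)). Qed.

Lemma idealM G c x : x \in ideal_of G -> c * x \in ideal_of G.
Proof. exact: (@rpredZ R R^o (ideal_of G) c). Qed.

Lemma ideal0 G : 0 \in ideal_of G.
Proof. exact: (@rpred0 R^o (ideal_of G)). Qed.

Lemma ideal_sub G W : (forall u, G u -> u \in ideal_of W) ->
  forall x, x \in ideal_of G -> x \in ideal_of W.
Proof.
move=> GW x /asboolP[s [Gs ->]]; rewrite big_seq.
apply: (big_ind (fun z => z \in ideal_of W)); first exact: ideal0.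
  by move=> y z; exact: idealD.
by move=> y ys; apply/idealM/GW/Gs.
Qed.

Lemma ideal_set0 x : x \in ideal_of (set0 : set R) -> x = 0.
Proof. by case/asboolP=> s [s0 ->]; rewrite big_seq big1 // => y /s0. Qed.

Lemma idealU1P G u x :
  x \in ideal_of (G `|` [set u])%classic <->
  exists i c, i \in ideal_of G /\ x = i + c * u.
Proof.
split=> [/asboolP[s [Gs ->]]|[i [c [iG ->]]]]; last first.
  apply: idealD; last by apply/idealM/ideal_gen; right.
  by move: i iG; apply: ideal_sub => v Gv; apply: ideal_gen; left.
rewrite big_seq.
apply: (big_ind (fun z => exists i c, i \in ideal_of G /\ z = i + c * u)).
- by exists 0, 0; rewrite ideal0 mul0r addr0.
- move=> _ _ [i [c [iG ->]]] [j [d [jG ->]]]; exists (i + j), (c + d).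
  by rewrite idealD // mulrDl addrACA.
- move=> y /Gs[Gy|->]; first by exists (y.1 * y.2), 0; rewrite mul0r addr0 idealM // ideal_gen.
  by exists 0, y.1; rewrite ideal0 add0r.
Qed.

Lemma projective_regular : projective_module R^o.
Proof.
move=> M N g h surj_g; have [x gx] := surj_g (h 1).
pose k (r : R^o) := r *: x.
have k_lin : linear k by move=> a b c; rewrite /k scalerDl scalerA.
pose kM := GRing.isLinear.Build R R^o M _ k k_lin.
pose kL : {linear R^o -> M} := HB.pack k kM.
exists kL => r; rewrite /= /k linearZ gx -linearZ; congr (h _).
exact: mulr1.
Qed.

(** If [(W)] is the colon ideal [(G) : u], the sequence
    [0 -> (W) -> (G) (+) R -> (G, u) -> 0] with the maps [c |-> (- c u, c)] and
    [(i, c) |-> i + c u] is exact. *)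
Lemma pdim_le_ideal_step d G W u :
  (forall c, (c * u \in ideal_of G) = (c \in ideal_of W)) ->
  pdim_le d (ideal_module W) -> pdim_le d.+1 (ideal_module G) ->
  pdim_le d.+1 (ideal_module (G `|` [set u])%classic).
Proof.
move=> colon pW pG.
pose B : lmodType R := (ideal_module G * R^o)%type.
have pB : pdim_le d.+1 B.
  apply: (pdim_le_ext (i := @inl_map R (ideal_module G) R^o : {linear _ -> B})
                      (g := snd : {linear B -> R^o})) pG _.
    split=> [x y [->]//|c|[i c]]; first by exists (0, c).
    by split=> [/= ->|[j [_ <-]]//]; exists i.
  exact/(@pdim_leW _ 0)/projective_regular.
have iP (c : R) : c \in ideal_of W -> - (c * u) \in ideal_of G.
  by move=> cW; apply: idealN; rewrite colon.
pose i (w : ideal_module W) : B := (IdealElt (iP _ (valP w)), val w).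
have i_lin : linear i.
  move=> a x y; congr (_, _); apply: val_inj.
  rewrite /= /GRing.scale /=; ring.
pose iM := GRing.isLinear.Build R (ideal_module W) B _ i i_lin.
pose iL : {linear ideal_module W -> B} := HB.pack i iM.
have gP (b : B) : (val b.1 : R) + b.2 * u \in ideal_of (G `|` [set u])%classic.
  by apply/idealU1P; exists (val b.1), b.2; split=> //; exact: valP.
pose g (b : B) : ideal_module (G `|` [set u])%classic := IdealElt (gP b).
have g_lin : linear g.
  move=> a x y; apply: val_inj.
  rewrite /= /GRing.scale /=; ring.
pose gM := GRing.isLinear.Build R B _ _ g g_lin.
pose gL : {linear B -> ideal_module (G `|` [set u])%classic} := HB.pack g gM.
apply: (pdim_le_quo (i := iL) (g := gL)) pW pB; split.
- by move=> x y [_ /val_inj].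
- move=> y; have /idealU1P[j [c [jG yE]]] := valP y.
  by exists (IdealElt jG, c); apply: val_inj; rewrite /= yE.
- move=> [j c]; split=> [/(congr1 val)/= jc0|[w <-]].
    have jE : val j = - (c * u) by apply/eqP; rewrite -addr_eq0 jc0.
    have cW : c \in ideal_of W.
      by rewrite -colon -[c * u]opprK -jE idealN // (valP j).
    by exists (IdealElt cW); congr (_, _); apply: val_inj; rewrite /= jE.
  by apply: val_inj; rewrite /= addNr.
Qed.

End Ideals.

Lemma pdim_le_principal (R : idomainType) (u : R) : u != 0 ->
  pdim_le 0 (ideal_module [set u]%classic).
Proof.
move=> u0; have fP (c : R) : c * u \in ideal_of [set u]%classic.
  exact/idealM/ideal_gen.
pose f (c : R^o) : ideal_module [set u]%classic := IdealElt (fP c).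
have f_lin : linear f.
  move=> a x y; apply: val_inj; rewrite /= /GRing.scale /=; ring.
pose fM := GRing.isLinear.Build R R^o _ _ f f_lin.
pose fL : {linear R^o -> ideal_module [set u]%classic} := HB.pack f fM.
apply: (projective_iso (f := fL)); last exact: projective_regular.
- by move=> x y /(congr1 val)/= /(mulIf u0).
- move=> y; have : val y \in ideal_of (set0 `|` [set u])%classic.
    by rewrite set0U; exact: valP.
  move=> /idealU1P[i [c [/ideal_set0 -> yE]]].
  by exists c; apply: val_inj; rewrite /= yE add0r.
Qed.

Section Variables.
Variables (K : fieldType) (T : finType).
Local Notation S := (mpoly #|T| K).
Implicit Types (D F : {set T}) (q : S).

Definition vars D : set S := [set Xvar K t | t in [set` D]]%classic.

(** Evaluation at [0] of the variables in [D], used to see that they generate a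
    prime ideal. *)
Definition kill D : S -> S :=
  comp_mpoly [tuple if enum_val j \in D then 0 else mpolyX K (mnm1 j) | j < #|T|].
HB.instance Definition _ D := GRing.RMorphism.on (kill D).

Lemma kill_Xvar D t : kill D (Xvar K t) = if t \in D then 0 else Xvar K t.
Proof.
rewrite /kill /Xvar comp_mpolyXU (nth_map (enum_rank t)) ?size_enum_ord //.
by rewrite nth_ord_enum enum_rankK.
Qed.

Lemma kill_Xmon D F : [disjoint F & D] -> kill D (Xmon K F) = Xmon K F.
Proof.
rewrite fintype.disjoint_subset => /fintype.subsetP FD.
rewrite /Xmon rmorph_prod; apply: eq_bigr => t /FD; rewrite inE /= kill_Xvar.
by move=> /negbTE ->.
Qed.

(** The difference [p - kill D p] always lies in the ideal: this holds for
    variables and constants and passes to sums and products. *)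
Lemma kill_vars D q : (q \in ideal_of (vars D)) = (kill D q == 0).
Proof.
have killP p : p - kill D p \in ideal_of (vars D).
  elim/mpolyind: p => [|c m p _ _ IHp]; first by rewrite rmorph0 subrr ideal0.
  rewrite rmorphD /= opprD addrACA; apply: idealD IHp.
  have -> : kill D (c *: mpolyX K m) = c *: kill D (mpolyX K m) by exact: comp_mpolyZ.
  rewrite -scalerBr -mul_mpolyC; apply: idealM.
  rewrite mpolyXE_id.
  apply: (big_ind (fun p => p - kill D p \in ideal_of (vars D))).
  - by rewrite rmorph1 subrr ideal0.
  - move=> x y Hx Hy; rewrite rmorphM /=.
    have -> : x * y - kill D x * kill D y =
      x * (y - kill D y) + kill D y * (x - kill D x) by ring.
    by rewrite idealD ?idealM.
  - move=> i _; elim: (m i) => [|k IHk]; first by rewrite expr0 rmorph1 subrr ideal0.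
    rewrite exprS rmorphM /=.
    have -> (x y : S) : x * y - kill D x * kill D y =
      x * (y - kill D y) + kill D y * (x - kill D x) by ring.
    apply: idealD; first exact: idealM.
    apply: idealM.
    have -> : mpolyX K (mnm1 i) = Xvar K (enum_val i) by rewrite /Xvar enum_valK.
    rewrite kill_Xvar.
    case: ifP => iD; last by rewrite subrr ideal0.
    by rewrite subr0 ideal_gen //; exists (enum_val i).
apply/idP/eqP => [/asboolP[s [Gs ->]]|q0].
  rewrite rmorph_sum /= big_seq big1 // => y /Gs[t /= tD <-].
  by rewrite rmorphM /= kill_Xvar tD mulr0.
by rewrite -[q]subr0 -q0.
Qed.

Lemma vars_colon D q u : kill D u != 0 ->
  (q * u \in ideal_of (vars D)) = (q \in ideal_of (vars D)).
Proof. by move=> u0; rewrite !kill_vars rmorphM /= mulf_eq0 (negbTE u0) orbF. Qed.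

Lemma Xvar_neq0 (t : T) : Xvar K t != 0.
Proof.
apply/eqP => /(congr1 (mcoeff (mnm1 (enum_rank t)))) /eqP.
by rewrite mcoeffX eqxx mcoeff0 oner_eq0.
Qed.

Lemma Xmon_neq0 F : Xmon K F != 0.
Proof. by apply/prodf_neq0 => t _; exact: Xvar_neq0. Qed.

Lemma varsU1 (t : T) D : vars (t |: D) = (vars D `|` [set Xvar K t])%classic.
Proof.
rewrite eqEsubset; split=> [_ [x /= /setU1P[->|xD] <-]|_ [[x /= xD <-]|->]].
- by right.
- by left; exists x.
- by exists x => //=; rewrite setU1r.
- by exists t => //=; rewrite setU11.
Qed.

Lemma vars0 : vars finset.set0 = set0.
Proof. by rewrite -subset0 => y [x /=]; rewrite inE. Qed.

(** A new variable is a nonzerodivisor modulo the previous ones. So the colon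
    ideal is the ideal of the previous ones, and each variable after the first
    costs one dimension. *)
Lemma pdim_le_vars D : D != finset.set0 -> pdim_le #|D|.-1 (ideal_module (vars D)).
Proof.
have [k] := ubnP #|D|; elim: k D => // k IHk D0 ltDk /finset.set0Pn[t tD0].
have tD : t \notin D0 :\ t by rewrite setD11.
have ltk : (#|D0 :\ t| < k)%N by move: ltDk; rewrite (cardsD1 t D0) tD0.
rewrite -(finset.setD1K tD0); move: (D0 :\ t)%SET tD ltk => D tD /IHk IHD {D0 tD0 ltDk}.
have [->|D0] := eqVneq D finset.set0.
  rewrite varsU1 vars0 set0U finset.setU0 cards1.
  exact/pdim_le_principal/Xvar_neq0.
rewrite varsU1 cardsU1 tD.
have := IHD D0; have : (0 < #|D|)%N by rewrite card_gt0.
case: #|D| => //= d _ pD.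
apply: (pdim_le_ideal_step _ pD (pdim_leS pD)).
by move=> c; rewrite vars_colon // kill_Xvar (negbTE tD) Xvar_neq0.
Qed.

(** Adding a generator whose colon ideal is generated by [r] variables gives
    dimension at most [r], one more than that of the colon ideal. *)
Lemma pdim_le_linear_quotients d (us : seq S) : us != [::] ->
  (forall u, u \in us -> u != 0) ->
  (forall us1 u us2, us = us1 ++ u :: us2 -> us1 != [::] ->
     exists2 D : {set T}, (#|D| <= d)%N &
       forall c, (c * u \in ideal_of [set` us1]%classic) = (c \in ideal_of (vars D))) ->
  pdim_le d (ideal_module [set` us]%classic).
Proof.
elim/last_ind: us => // us u IHus _ us0 lq.
have [us_nil|us_neq] := eqVneq us [::].
  rewrite us_nil; have -> : [set` rcons [::] u]%classic = [set u]%classic.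
    by apply/seteqP; split=> x; rewrite /= inE => /eqP.
  apply/(@pdim_leW _ 0)/pdim_le_principal/us0 => //.
  by rewrite mem_rcons mem_head.
have [D Dd colon] := lq us u [::] (esym (cats1 _ _)) us_neq.
(* The colon ideal contains the earlier generators, so D is not empty. *)
have D0 : D != finset.set0.
  apply/eqP => D0; case: us us_neq us0 colon {IHus lq} => // v us _ us0 colon.
  have : v \in ideal_of (vars D).
    by rewrite -colon mulrC idealM // ideal_gen //= mem_head.
  by rewrite D0 vars0 => /ideal_set0; apply/eqP/us0; rewrite rcons_cons mem_head.
have D_gt0 : (0 < #|D|)%N by rewrite card_gt0.
case: d Dd {colon lq} (colon) (lq) IHus => [|d] Dd colon lq IHus; first by rewrite leqNgt D_gt0 in Dd.
have -> : [set` rcons us u]%classic = ([set` us] `|` [set u])%classic.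
  apply/seteqP; split=> x; rewrite /= mem_rcons inE.
    by move=> /orP[/eqP|]; [right | left].
  by move=> [->|->]; rewrite ?eqxx ?orbT.
apply: (pdim_le_ideal_step colon).
  by apply: pdim_leW (pdim_le_vars D0); case: #|D| Dd.
apply: IHus => // [v vus|us1 v us2 usE]; first by apply: us0; rewrite mem_rcons inE vus orbT.
by apply: (lq us1 v (rcons us2 u)); rewrite usE rcons_cat.
Qed.

End Variables.

(** * Koszul homology of modules of finite projective dimension *)

Section Koszul.
Variable R : comNzRingType.
Implicit Types (M N : lmodType R) (y : R) (ys : seq R) (s : bitseq).

(** The Koszul differential. Strings of bits index the basis of the exterior
    algebra, a bit telling whether the basis vector occurs, and the recursion
    presents the complex of [y :: ys'] as the mapping cone of multiplication by
    [y] on the complex of [ys']. *)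
Fixpoint koszul M ys (c : bitseq -> M) (s : bitseq) : M :=
  match ys, s with
  | y :: ys', false :: s' =>
      koszul ys' (fun s => c (false :: s)) s' + y *: c (true :: s')
  | y :: ys', true :: s' => - koszul ys' (fun s => c (true :: s)) s'
  | _, _ => 0
  end.

Definition chain M (k j : nat) (c : bitseq -> M) : Prop :=
  forall s, c s != 0 -> size s = k /\ count id s = j.

Definition koszul_exact M ys j : Prop :=
  forall c, chain (size ys) j c -> koszul (M := M) ys c =1 (fun=> 0) ->
  exists2 e, chain (size ys) j.+1 e & koszul ys e =1 c.

Lemma eq_koszul M ys (c1 c2 : bitseq -> M) :
  c1 =1 c2 -> koszul ys c1 =1 koszul ys c2.
Proof. by move=> /funext ->. Qed.

Lemma koszul_lin M ys a (c1 c2 : bitseq -> M) s :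
  koszul ys (fun s => a *: c1 s + c2 s) s = a *: koszul ys c1 s + koszul ys c2 s.
Proof.
elim: ys c1 c2 s => [|y ys IHys] c1 c2 [|[] s] /=; rewrite ?scaler0 ?addr0 //.
  by rewrite IHys opprD scalerN.
by rewrite IHys !scalerDr !scalerA [y * a]mulrC addrACA.
Qed.

Lemma koszul0 M ys s : koszul ys (fun=> 0 : M) s = 0.
Proof.
elim: ys s => [|y ys IHys] [|[] s] //=; first by rewrite IHys oppr0.
by rewrite IHys scaler0 addr0.
Qed.

Lemma koszulZ M ys a (c : bitseq -> M) s :
  koszul ys (fun s => a *: c s) s = a *: koszul ys c s.
Proof.
have := koszul_lin ys a c (fun=> 0) s; rewrite koszul0 addr0 => <-.
by apply: eq_koszul => t; rewrite addr0.
Qed.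

Lemma koszulD M ys (c1 c2 : bitseq -> M) s :
  koszul ys (fun s => c1 s + c2 s) s = koszul ys c1 s + koszul ys c2 s.
Proof.
have := koszul_lin ys 1 c1 c2 s; rewrite scale1r => <-.
by apply: eq_koszul => t; rewrite scale1r.
Qed.

Lemma koszulN M ys (c : bitseq -> M) s :
  koszul ys (fun s => - c s) s = - koszul ys c s.
Proof.
rewrite -scaleN1r -koszulZ.
by apply: eq_koszul => t; rewrite scaleN1r.
Qed.

Lemma koszul_map M N (g : {linear M -> N}) ys (c : bitseq -> M) s :
  g (koszul ys c s) = koszul ys (g \o c) s.
Proof.
elim: ys c s => [|y ys IHys] c [|[] s] /=; rewrite ?linear0 ?linearN ?IHys //.
by rewrite linearD linearZ IHys.
Qed.

Lemma koszulK M ys (c : bitseq -> M) s : koszul ys (koszul ys c) s = 0.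
Proof.
elim: ys c s => [|y ys IHys] c [|[] s] //=; first by rewrite koszulN IHys !oppr0.
by rewrite koszulD koszulZ IHys add0r scalerN addrN.
Qed.

Lemma chain_cons M k j (b : bool) (c : bitseq -> M) :
  chain k.+1 (b + j) c -> chain k j (fun s => c (b :: s)).
Proof. by move=> cc s /cc[[<-] /addnI]. Qed.

Lemma chain_true0 M k (c : bitseq -> M) s : chain k 0 c -> c (true :: s) = 0.
Proof. by move=> cc; apply/eqP/negPn/negP => /cc[]. Qed.

Lemma koszul_deg0 M ys (c : bitseq -> M) s :
  chain (size ys) 0 c -> koszul ys c s = 0.
Proof.
elim: ys c s => [|y ys IHys] c [|[] s] //= cc.
  rewrite (@eq_koszul _ _ _ (fun=> 0)) ?koszul0 ?oppr0 // => t.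
  exact: chain_true0 cc.
rewrite (chain_true0 _ cc) scaler0 addr0; apply: IHys.
exact: (@chain_cons _ _ _ false).
Qed.

Lemma chain_koszul M ys j (c : bitseq -> M) :
  chain (size ys) j.+1 c -> chain (size ys) j (koszul ys c).
Proof.
elim: ys j c => [|y ys IHys] j c cc [|[] s] /=; rewrite ?eqxx //.
  case: j cc => [|j] cc.
    by rewrite koszul_deg0 ?oppr0 ?eqxx //; exact: (@chain_cons _ _ _ true).
  rewrite oppr_eq0 => nz; have [|-> ->] := IHys j _ _ s nz => //.
  exact: (@chain_cons _ _ _ true).
have [-> |nz _] := eqVneq (koszul ys (fun s => c (false :: s)) s) 0.
  rewrite add0r => nz; have /cc[[->] [<-]] // : c (true :: s) != 0.
  by apply: contraNneq nz => ->; rewrite scaler0.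
by have [|-> ->] := IHys j _ _ s nz => //; exact: (@chain_cons _ _ _ false).
Qed.

Lemma chainD M k j (c1 c2 : bitseq -> M) :
  chain k j c1 -> chain k j c2 -> chain k j (fun s => c1 s + c2 s).
Proof.
move=> cc1 cc2 s; have [->|/cc1//] := eqVneq (c1 s) 0.
by rewrite add0r; exact: cc2.
Qed.

Lemma chainZ M k j a (c : bitseq -> M) : chain k j c -> chain k j (fun s => a *: c s).
Proof. by move=> cc s nz; apply: cc; apply: contraNneq nz => ->; rewrite scaler0. Qed.

(** Membership in [(ys) M], unfolded in the same order as [koszul]. *)
Fixpoint in_span M ys (q : M) : Prop :=
  if ys is y :: ys' then exists r, in_span ys' (q - y *: r) else q = 0.

Lemma in_span_map M N (g : {linear M -> N}) ys q : in_span ys q -> in_span ys (g q).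
Proof.
elim: ys q => [|y ys IHys] q /=; first by move=> ->; rewrite linear0.
by move=> [r /IHys Hr]; exists (g r); rewrite -linearZ -linearB.
Qed.

(** Regularity is read from the end of the list, the order in which [koszul] takes
    mapping cones. *)
Definition regular_seq M ys : Prop :=
  forall ys1 y ys2, ys = ys1 ++ y :: ys2 ->
  forall q : M, in_span ys2 (y *: q) -> in_span ys2 q.

Lemma in_span_koszul M ys (e : bitseq -> M) : chain (size ys) 1 e ->
  in_span ys (koszul ys e (nseq (size ys) false)).
Proof.
elim: ys e => [|y ys IHys] e ce //=.
exists (e (true :: nseq (size ys) false)); rewrite addrK; apply: IHys.
exact: (@chain_cons _ _ _ false).
Qed.

Lemma koszul_in_span M ys (q : M) : in_span ys q ->
  exists2 e, chain (size ys) 1 e &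
    koszul ys e =1 (fun s => if s == nseq (size ys) false then q else 0).
Proof.
elim: ys q => [|y ys IHys] q /=.
  by move=> ->; exists (fun=> 0) => s; rewrite ?eqxx ?if_same.
move=> [r /IHys[e ce de]].
exists (fun s => if s is b :: s' then
    if b then if s' == nseq (size ys) false then r else 0 else e s' else 0).
  move=> [|[] s] /=; rewrite ?eqxx //; last by move=> /ce[-> ->].
  have [-> _|_] := eqVneq s (nseq (size ys) false); last by rewrite eqxx.
  by rewrite size_nseq count_nseq.
move=> [|[] s] //=.
  rewrite koszul_deg0 ?oppr0 // => t.
  have [-> _|_] := eqVneq t (nseq (size ys) false); last by rewrite eqxx.
  by rewrite size_nseq count_nseq.
rewrite de eqseq_cons /=; case: eqP => _; first by rewrite subrK.
by rewrite scaler0 addr0.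
Qed.

(** In the mapping cone a cycle is a pair [(a, b)] where [b] is a cycle and the
    boundary of [a] is [- y b]. Once [b] is the boundary of some [b'], the chain
    [a + y b'] is a cycle of the smaller complex, hence a boundary. In degree one
    [b] is a single element and need not be a boundary for degree reasons, but
    [y b] lies in the span of the other elements, and regularity puts [b]
    there. *)
Lemma regular_exact M ys j : regular_seq M ys -> koszul_exact M ys j.+1.
Proof.
elim: ys j => [|y ys IHys] j reg c cc dc.
  exists (fun=> 0); first by move=> s; rewrite eqxx.
  move=> s /=; apply/esym/eqP/negPn/negP => /cc[/size0nil ->] //.
have {}IHys i : koszul_exact M ys i.+1.
  by apply: IHys => ys1 z ys2 ysE; apply: (reg (y :: ys1)); rewrite ysE.
pose a s := c (false :: s); pose b s := c (true :: s).
have ca : chain (size ys) j.+1 a by exact: (@chain_cons _ _ _ false).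
have cb : chain (size ys) j b by exact: (@chain_cons _ _ _ true).
have db s : koszul ys b s = 0 by have /eqP := dc (true :: s); rewrite oppr_eq0 => /eqP.
have da s : koszul ys a s + y *: b s = 0 by exact: dc (false :: s).
have [b' cb' db'] : exists2 b', chain (size ys) j.+1 b' & koszul ys b' =1 b.
  case: j cb ca {cc} => [|j] cb ca; last exact: IHys.
  pose o := nseq (size ys) false.
  have /koszul_in_span[b' cb' db'] : in_span ys (b o).
    apply: (reg [::] y) => //.
    have -> : y *: b o = koszul ys (fun s => -1 *: a s) o.
      by rewrite koszulZ scaleN1r; apply/eqP; rewrite -addr_eq0 addrC da.
    exact/in_span_koszul/chainZ.
  exists b' => // s; rewrite db'; case: eqP => [->//|so].
  apply/esym/eqP/negPn/negP => /cb[sz cnt]; apply: so.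
  rewrite -sz; elim: s cnt {sz} => // -[] s IHs //= /eqP; rewrite ?add0n => /eqP /IHs.
  by move=> {1}->.
have [a' ca' da'] : exists2 a', chain (size ys) j.+2 a' &
    koszul ys a' =1 (fun s => a s + y *: b' s).
  apply: IHys; first by apply: chainD => //; exact: chainZ.
  by move=> s; rewrite koszulD koszulZ db' da.
exists (fun s => if s is t :: s' then if t then - b' s' else a' s' else 0).
  move=> [|[] s] /=; rewrite ?eqxx // ?oppr_eq0; last by move=> /ca'[-> ->].
  by move=> /cb'[-> ->].
move=> [|[] s] //=; last by rewrite da' scalerN addrK.
  by apply/esym/eqP/negPn/negP => /cc[].
by rewrite koszulN db' opprK.
Qed.

(** Dimension shifting: a cycle with values in [M] is lifted to the projective
    cover, and the boundary of the lift is a cycle of the syzygy, one degree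
    lower. *)
Lemma pdim_le_koszul_exact M ys d j :
  (forall Q, projective_module Q -> regular_seq Q ys) ->
  pdim_le d M -> (d < j)%N -> koszul_exact M ys j.
Proof.
move=> reg; elim: d j M => [|d IHd] j M.
  by move=> /reg; case: j => // j + _; exact: regular_exact.
move=> [K [Q [i [g [[inj_i surj_g ex] pQ pK]]]]]; case: j => // j dj c cc dc.
have [h gh] := choice surj_g.
pose z s := if c s == 0 then 0 else h (c s).
have gz s : g (z s) = c s.
  by rewrite /z; case: eqP => [->|_]; rewrite ?linear0 ?gh.
have cz : chain (size ys) j.+1 z.
  by move=> s; rewrite /z; have [_|/cc//] := eqVneq (c s) 0; rewrite eqxx.
have : forall s, exists a, i a = koszul ys z s.
  move=> s; apply/ex; rewrite koszul_map.
  by rewrite (@eq_koszul _ _ _ c) ?dc // => t; exact: gz.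
move=> /choice[w iw].
have cw : chain (size ys) j w.
  move=> s nz; apply: (chain_koszul cz); rewrite -iw.
  by apply: contraNneq nz => i0; apply/eqP/inj_i; rewrite i0 linear0.
have dw : koszul ys w =1 (fun=> 0).
  move=> s; apply: inj_i; rewrite linear0 koszul_map.
  by rewrite (@eq_koszul _ _ _ (koszul ys z)) ?koszulK.
have [v cv dv] := IHd j K pK dj w cw dw.
have civ : chain (size ys) j.+1 (i \o v).
  by move=> s /= nz; apply: cv; apply: contraNneq nz => ->; rewrite linear0.
have [e ce de] : exists2 e, chain (size ys) j.+2 e &
    koszul ys e =1 (fun s => z s + -1 *: (i \o v) s).
  apply: (regular_exact (reg _ pQ)).
    by apply: chainD => //; exact: chainZ.
  by move=> s; rewrite koszulD koszulZ -koszul_map dv iw scaleN1r subrr.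
exists (g \o e).
  by move=> s /= nz; apply: ce; apply: contraNneq nz => ->; rewrite linear0.
move=> s; rewrite -koszul_map de linearD linearZ /= gz.
by rewrite (ex (i (v s))).2 ?scaler0 ?addr0 //; exists (v s).
Qed.

End Koszul.

(** * Koszul cycles over a polynomial ring *)

Section ProjectiveRegular.
Variables (K : fieldType) (T : finType).
Local Notation S := (mpoly #|T| K).
Implicit Types (D : {set T}) (ts : seq T).

Lemma in_span_vars ts (q : S) :
  in_span (M := S^o) [seq Xvar K t | t <- ts] q <-> q \in ideal_of (vars [set t in ts]%SET : set S).
Proof.
elim: ts q => [|t ts IHts] q /=.
  have -> : [set x in Nil T]%SET = finset.set0 by apply/setP => t; rewrite !inE.
  rewrite vars0.
  by split=> [->|/ideal_set0//]; exact: ideal0.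
have -> : [set x in t :: ts]%SET = (t |: [set x in ts])%SET by apply/setP => x; rewrite !inE.
have scE (r : S^o) : Xvar K t *: r = r * Xvar K t by exact: mulrC.
rewrite varsU1; split=> [[r /IHts]|/idealU1P[i [c [iG ->]]]]; rewrite ?scE.
  by move=> Hr; apply/idealU1P; exists (q - r * Xvar K t), r; rewrite subrK.
by exists c; rewrite scE addrK; apply/IHts.
Qed.

Lemma in_span0 (M : lmodType S) ys : in_span (M := M) ys 0.
Proof. by elim: ys => [|y ys IHys] //=; exists 0; rewrite scaler0 subr0. Qed.

Section FreeCover.
Variable Q : lmodType S.
Local Notation F := (malg Q S).

(** Only finitely many coefficients are nonzero, so the witnesses found for each
    of them can be assembled. *)
Lemma in_span_malg ys (f : F) :
  (forall k, in_span (M := S^o) ys (monalg.mcoeff k f)) -> in_span ys f.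
Proof.
elim: ys f => [|y ys IHys] f /= Hf.
  by apply/monalg.malgP => k; rewrite Hf monalg.mcoeff0.
have [r Hr] := choice Hf.
pose g : F := \sum_(k <- finmap.enum_fset (monalg.msupp f)) monalg.mkmalgU k (r k).
have gE k : monalg.mcoeff k g = if k \in monalg.msupp f then r k else 0.
  rewrite /g raddf_sum /=; case: ifP => kf; last first.
    rewrite big_seq big1 // => l lf; rewrite monalg.mcoeffU.
    by case: eqP lf => // ->; rewrite kf.
  rewrite (finmap.big_fsetD1 k) //= monalg.mcoeffUU big_seq big1 ?addr0 // => l.
  by rewrite finmap.in_fsetD1 => /andP[/negbTE lk _]; rewrite monalg.mcoeffU lk.
exists g; apply: IHys => k; rewrite monalg.mcoeffB monalg.mcoeffZ gE.
case: ifP => [_|kf]; first exact: Hr.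
rewrite monalg.mcoeff_outdom ?kf // mulr0 subr0; exact: in_span0.
Qed.

Definition free_eval (f : F) : Q :=
  \sum_(k <- finmap.enum_fset (monalg.msupp f)) monalg.mcoeff k f *: k.

Lemma free_evalE (f : F) (D : finset_of (Phant Q)) :
  finmap.fsubset (monalg.msupp f) D ->
  free_eval f = \sum_(k <- finmap.enum_fset D) monalg.mcoeff k f *: k.
Proof.
move=> fD; rewrite /free_eval; apply: finmap.big_fset_incl => // k _ kf.
by rewrite monalg.mcoeff_outdom // scale0r.
Qed.

Fact free_eval_linear : linear free_eval.
Proof.
move=> a f g; pose D := finmap.fsetU (monalg.msupp f) (monalg.msupp g).
rewrite (@free_evalE f D) ?finmap.fsubsetUl // (@free_evalE g D) ?finmap.fsubsetUr //.
rewrite (@free_evalE _ D).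
  rewrite scaler_sumr -big_split; apply: eq_bigr => k _ /=.
  by rewrite monalg.mcoeffD monalg.mcoeffZ scalerDl scalerA.
apply/finmap.fsubsetP => k; rewrite finmap.in_fsetU -!monalg.mcoeff_neq0.
rewrite monalg.mcoeffD monalg.mcoeffZ.
have [->|//] := eqVneq (monalg.mcoeff k f) 0.
by have [->|//] := eqVneq (monalg.mcoeff k g) 0; rewrite mulr0 addr0 eqxx.
Qed.

HB.instance Definition _ := GRing.isLinear.Build S F Q _ free_eval free_eval_linear.

Lemma free_eval_surj q : exists f : F, free_eval f = q.
Proof.
exists (monalg.mkmalgU q 1).
rewrite (@free_evalE _ (finmap.fset1 q)) ?monalg.msuppU_le //.
by rewrite finmap.big_seq_fset1 monalg.mcoeffUU scale1r.
Qed.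

(** A projective module is a direct summand of a free one, where regularity is
    checked coefficientwise and follows from the primality of the ideals of
    variables. *)
Lemma projective_regular_vars ts : uniq ts -> projective_module Q ->
  regular_seq Q [seq Xvar K t | t <- ts].
Proof.
move=> uts pQ ys1 y ys2 tsE q Hq.
have [t [ts2 [yE ys2E tts2]]] : exists t ts2,
    [/\ y = Xvar K t, ys2 = [seq Xvar K t | t <- ts2] & t \notin ts2].
  elim: ts ys1 uts tsE => [|t ts IHts] [|z ys1] //= /andP[tts uts] [].
    by move=> <- <-; exists t, ts.
  by move=> _; exact: IHts.
rewrite {}yE {}ys2E {tsE} in Hq *.
have [s es] := pQ _ _ (free_eval : {linear F -> Q}) idfun free_eval_surj.
rewrite -[q]es; apply: (in_span_map (free_eval : {linear F -> Q})).
apply: in_span_malg => k; apply/in_span_vars.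
have : in_span [seq Xvar K t | t <- ts2] (Xvar K t *: s q).
  by rewrite -linearZ; exact: in_span_map.
pose c (f : F) : S^o := monalg.mcoeff k f.
have c_lin : linear c by move=> a f g; rewrite /c monalg.mcoeffD monalg.mcoeffZ.
pose cM := GRing.isLinear.Build S F S^o _ c c_lin.
pose cL : {linear F -> S^o} := HB.pack c cM.
move=> /(in_span_map cL); rewrite /= /c monalg.mcoeffZ => /in_span_vars.
rewrite mulrC vars_colon // kill_Xvar ifN ?Xvar_neq0 //.
by rewrite inE.
Qed.

End FreeCover.

Implicit Types (b : seq T) (bs : seq (seq T)) (xs : seq T).

(** All variables are sent to ['X], so that divisibility by powers of ['X] measures
    the order of a polynomial at the origin. *)
Definition diag : S -> {poly K} := mmap (@polyC K) (fun _ => 'X%R).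
HB.instance Definition _ := GRing.RMorphism.on diag.

Lemma diag_Xvar (t : T) : diag (Xvar K t) = 'X.
Proof. by rewrite /diag /Xvar mmapX mmap1U. Qed.

(** The exterior product of all basis vectors. *)
Definition top (r : nat) (s : bitseq) : S := (s == nseq r true)%:R.

(** The exterior product of chains on two consecutive blocks of variables. *)
Definition chain_mul (r : nat) (c1 c2 : bitseq -> S) (s : bitseq) : S :=
  c1 (take r s) * c2 (drop r s).

(** The product of the boundaries of the top cells of the blocks, an algebraic
    counterpart of the join of the boundaries of simplices. *)
Fixpoint sphere_cycle bs : bitseq -> S :=
  if bs is b :: bs' then
    chain_mul (size b) (koszul (M := S^o) [seq Xvar K t | t <- b] (top (size b)))
      (sphere_cycle bs')
  else fun s => (s == [::])%:R.

(** In the Leibniz rule the term with the boundary of [c2] vanishes, and with it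
    the only sign. *)
Lemma koszul_mul (ys1 ys2 : seq S) (c1 c2 : bitseq -> S^o) :
  koszul ys2 c2 =1 (fun=> 0) ->
  koszul (M := S^o) (ys1 ++ ys2) (chain_mul (size ys1) c1 c2) =1
  chain_mul (size ys1) (koszul ys1 c1) c2.
Proof.
move=> dc2; elim: ys1 c1 => [|y ys1 IH] c1 s /=.
  rewrite (@eq_koszul _ _ _ _ (fun s => c1 [::] *: c2 s)) => [|t].
    by rewrite koszulZ dc2 scaler0 /chain_mul mul0r.
  by rewrite /chain_mul take0 drop0.
case: s => [|[] s] /=; rewrite [RHS]/chain_mul /= ?mul0r //.
  by rewrite mulNr; congr (- _); exact: (IH (fun s => c1 (true :: s)) s).
rewrite mulrDl; congr (_ + _); first exact: (IH (fun s => c1 (false :: s)) s).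
exact: mulrA.
Qed.

Lemma koszul_sphere_cycle bs :
  koszul (M := S^o) [seq Xvar K t | t <- flatten bs] (sphere_cycle bs) =1 (fun=> 0).
Proof.
elim: bs => [|b bs IHbs] s //=.
rewrite map_cat -(size_map (@Xvar K T) b) koszul_mul //.
by rewrite /chain_mul koszulK mul0r.
Qed.

Lemma chain_mulP r1 r2 j1 j2 (c1 c2 : bitseq -> S^o) :
  chain r1 j1 c1 -> chain r2 j2 c2 -> chain (M := S^o) (r1 + r2) (j1 + j2) (chain_mul r1 c1 c2).
Proof.
move=> cc1 cc2 s; rewrite mulf_eq0 negb_or => /andP[/cc1[s1 t1] /cc2[s2 t2]].
by rewrite -(cat_take_drop r1 s) size_cat count_cat s1 t1 s2 t2.
Qed.

Lemma chain_top r : chain (M := S^o) r r (top r).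
Proof.
move=> s; rewrite /top; have [->|_] := eqVneq s (nseq r true); last by rewrite eqxx.
by rewrite size_nseq count_nseq /= mul1n.
Qed.

Lemma chain_sphere_cycle bs : [::] \notin bs ->
  chain (M := S^o) (size (flatten bs)) (sumn [seq (size b).-1 | b <- bs]) (sphere_cycle bs).
Proof.
elim: bs => [_|b bs IHbs] /=.
  by move=> s; have [->|_] := eqVneq s [::]; rewrite ?eqxx.
rewrite inE negb_or size_cat => /andP[b0 /IHbs cbs]; apply: chain_mulP => //.
rewrite -{1}(size_map (@Xvar K T) b); apply: chain_koszul; rewrite size_map.
by case: b b0 => // t b _; exact: chain_top.
Qed.

(** Omitting the first variable of each block selects one term of each boundary,
    so the cycle does not vanish even in lowest order. *)
Lemma sphere_cycle_value bs : [::] \notin bs ->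
  exists2 s, size s = size (flatten bs) & exists2 xs, size xs = size bs &
    sphere_cycle bs s = \prod_(x <- xs) Xvar K x.
Proof.
elim: bs => [_|[|t b] bs IHbs] //=.
  by exists [::] => //; exists [::]; rewrite ?big_nil ?eqxx.
rewrite inE => /IHbs[s sz [xs szx vE]].
exists (false :: nseq (size b) true ++ s); first by rewrite /= !size_cat size_nseq sz.
exists (t :: xs); first by rewrite /= szx.
rewrite big_cons -vE /chain_mul /= take_size_cat ?drop_size_cat ?size_nseq //.
congr (_ * _); rewrite {2}/top /= eqxx /GRing.scale /= mulr1.
rewrite (@eq_koszul _ _ _ _ (fun=> 0)) ?koszul0 ?add0r //.
Qed.

Lemma koszul_top_value b s :
  exists2 c : S, koszul (M := S^o) [seq Xvar K t | t <- b] (top (size b)) s = c &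
    c = 0 \/ exists2 t, t \in b & exists a, c = a * Xvar K t.
Proof.
eexists; first reflexivity.
elim: b s => [|t b IHb] s /=; first by left.
case: s => [|[] s]; [by left| |].
  have : (fun s => top (size b).+1 (true :: s)) = top (size b) :> (bitseq -> S^o).
    by apply/funext => s'; rewrite /top /= eqseq_cons.
  move=> ->; case: (IHb s) => [->|[u ub [a ->]]]; first by left; rewrite oppr0.
  by right; exists u; rewrite ?inE ?ub ?orbT //; exists (- a); rewrite mulNr.
right; exists t; first exact: mem_head.
exists (top (size b).+1 (true :: s)).
rewrite (@eq_koszul _ _ _ _ (fun=> 0)) ?koszul0 ?add0r //.
exact: mulrC.
Qed.

Lemma sphere_cycle_mem bs s : exists xs a,
  sphere_cycle bs s = a * \prod_(x <- xs) Xvar K x /\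
  (a = 0 \/ all2 (fun x b => x \in b) xs bs).
Proof.
elim: bs s => [|b bs IHbs] s /=.
  by exists [::], (s == [::])%:R; rewrite big_nil mulr1; split=> //; right.
have [xs [a [vE va]]] := IHbs (drop (size b) s).
have [c cE cP] := koszul_top_value b (take (size b) s).
rewrite /chain_mul cE vE.
case: cP => [->|[t tb [d ->]]].
  by exists [::], 0; rewrite !mul0r; split=> //; left.
case: va => [->|va]; first by exists [::], 0; rewrite !(mul0r, mulr0); split=> //; left.
exists (t :: xs), (d * a); rewrite big_cons /= tb; split; last by right.
ring.
Qed.

(** Some coefficient of the cycle has order exactly [size bs], while those of the
    boundary of a chain with values in the ideal have order greater than
    [size bs]. So the class of the cycle in the Koszul homology of the ideal is
    not zero, and its degree cannot exceed the projective dimension. *)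
Lemma koszul_degree_bound (G : set S) bs d :
  uniq (flatten bs) -> [::] \notin bs ->
  (forall xs, all2 (fun x b => x \in b) xs bs -> \prod_(x <- xs) Xvar K x \in ideal_of G) ->
  (forall u, G u -> exists q, diag u = 'X^(size bs) * q) ->
  pdim_le d (ideal_module G) -> (sumn [seq (size b).-1 | b <- bs] <= d)%N.
Proof.
move=> ubs bs0 GL Gdeg pG; rewrite leqNgt; apply/negP => dN.
pose ys := [seq Xvar K t | t <- flatten bs].
have szys : size ys = size (flatten bs) by rewrite size_map.
have cL s : sphere_cycle bs s \in ideal_of G.
  have [xs [a [-> [->|/GL xsL]]]] := sphere_cycle_mem bs s.
    by rewrite mul0r ideal0.
  exact: idealM.
pose c s : ideal_module G := IdealElt (cL s).
have cc : chain (size ys) (sumn [seq (size b).-1 | b <- bs]) c.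
  move=> s nz; rewrite szys; apply: (chain_sphere_cycle bs0).
  by apply: contraNneq nz => c0; apply/eqP/val_inj.
have dc : koszul ys c =1 (fun=> 0).
  move=> s; apply: val_inj; rewrite (koszul_map (val : {linear ideal_module G -> S^o})).
  exact: koszul_sphere_cycle.
have reg Q : projective_module Q -> regular_seq Q ys by exact: projective_regular_vars.
have [e _ de] := pdim_le_koszul_exact reg pG dN cc dc.
have [s _ [xs szx vE]] := sphere_cycle_value bs0.
have degL p : p \in ideal_of G -> exists q, diag p = 'X^(size bs) * q.
  move=> /asboolP[l [Gl ->]]; rewrite big_seq.
  apply: (big_ind (fun p => exists q, diag p = 'X^(size bs) * q)).
  - by exists 0; rewrite rmorph0 mulr0.
  - by move=> x y [q1 e1] [q2 e2]; exists (q1 + q2); rewrite rmorphD /= e1 e2 mulrDr.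
  - move=> y /Gl/Gdeg[q qE]; exists (diag y.1 * q).
    by rewrite rmorphM /= qE mulrCA.
have degK zs (f : bitseq -> S^o) t : all (fun y => diag y == 'X) zs ->
    (forall t, exists q, diag (f t) = 'X^(size bs) * q) ->
    exists q, diag (koszul zs f t) = 'X^((size bs).+1) * q.
  elim: zs f t => [|z zs IHzs] f [|[] t] /=; try by exists 0; rewrite rmorph0 mulr0.
    move=> /andP[_ /IHzs IH] Hf; have [q qE] := IH (fun s => f (true :: s)) t (fun s => Hf _).
    by exists (- q); rewrite rmorphN /= qE mulrN.
  move=> /andP[/eqP zX /IHzs IH] Hf.
  have [q qE] := IH (fun s => f (false :: s)) t (fun s => Hf _).
  have [q' qE'] := Hf (true :: t).
  exists (q + q'); rewrite rmorphD /= qE [z *: _]/GRing.scale /= rmorphM /= zX qE'.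
  by rewrite mulrA -exprS mulrDr.
have [|q] := degK ys (val \o e) s _ (fun t => degL _ (valP (e t))).
  by apply/allP => _ /mapP[t _ ->]; rewrite diag_Xvar.
have -> : koszul ys (val \o e) s = \prod_(x <- xs) Xvar K x.
  by rewrite -vE -(koszul_map (val : {linear ideal_module G -> S^o})) de.
rewrite rmorph_prod /= (eq_bigr _ (fun x _ => diag_Xvar x)).
rewrite big_const_seq count_predT szx iter_mulr_1 exprSr -mulrA -{1}['X^_]mulr1.
move=> /(mulfI (monic_neq0 (monicXn _ _))) /(congr1 (horner^~ 0)) /eqP.
by rewrite hornerM hornerX mul0r hornerC oner_eq0.
Qed.

End ProjectiveRegular.

(** * Descents and the collapse of the complex of a poset ideal *)

Section Ideal.
Variables (disp : Order.disp_t) (P : finPOrderType disp) (n : nat).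
Local Notation T := (P * 'I_n)%type.
Implicit Types (f g h : {ffun P -> 'I_n}) (q r : P) (a : 'I_n) (x : T) (H F : {set T}).
Variable AA : {set {ffun P -> 'I_n}}.

Definition isotone f := forall q r, (q <= r)%O -> (f q <= f r)%N.

Definition values q : {set 'I_n} := [set f q | f : {ffun P -> 'I_n} in AA]%SET.

Definition cells : {set T} := [set x : T | x.2 \in values x.1]%SET.

Hypothesis AA_iso : forall f, f \in AA -> isotone f.
Hypothesis AA_closed : forall f h, f \in AA -> isotone h ->
  (forall q, h q \in values q) -> (forall q, (h q <= f q)%N) -> h \in AA.

Lemma mem_values f q : f \in AA -> f q \in values q.
Proof. by move=> fA; apply: imset_f. Qed.

Lemma mem_graph f x : (x \in graph f) = (x.2 == f x.1).
Proof.
apply/imsetP/eqP => [[q _ ->]//|xE]; exists x.1 => //.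
by rewrite -xE -surjective_pairing.
Qed.

Lemma graph_cells f : f \in AA -> graph f \subset cells.
Proof.
move=> fA; apply/fintype.subsetP => x; rewrite mem_graph inE => /eqP ->.
exact: mem_values.
Qed.

(** The ways to lower [f] at a single place within the values of [AA]. *)
Definition descents f : {set T} :=
  [set x in cells | (x.2 < f x.1)%N && [forall q, (q < x.1)%O ==> (f q <= x.2)%N]]%SET.

Lemma descentsP f q a : reflect
  [/\ a \in values q, (a < f q)%N & forall r, (r < q)%O -> (f r <= a)%N]
  ((q, a) \in descents f).
Proof.
rewrite !inE /=; apply: (iffP and3P) => -[aB af H]; split=> //.
  by move=> r rq; have /forallP/(_ r) := H; rewrite rq.
by apply/forallP => r; apply/implyP; exact: H.
Qed.

Definition lower f q a : {ffun P -> 'I_n} := [ffun r => if r == q then a else f r].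

Lemma lower_mem f q a : f \in AA -> (q, a) \in descents f -> lower f q a \in AA.
Proof.
move=> fA /descentsP[aB af H]; apply: (AA_closed fA) => [r s rs|r|r]; rewrite !ffunE.
- have [rq|rq] := eqVneq r q; have [sq|sq] := eqVneq s q => //.
  + by apply: leq_trans (ltnW af) _; apply: (AA_iso fA); rewrite -rq.
  + by apply: H; rewrite lt_neqAle rq -sq.
  + exact: (AA_iso fA).
- by case: eqP => [->//|_]; exact: mem_values.
- by case: eqP => [->|_]; rewrite ?(ltnW af).
Qed.

Lemma minimal_place (S : {pred P}) q0 : q0 \in S ->
  exists2 q, q \in S & forall r, (r < q)%O -> r \notin S.
Proof.
move=> q0S.
case: (@arg_minnP _ q0 [in S] (fun q => #|[set r | (r < q)%O]%SET|) q0S) => q qS qmin.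
exists q => // r rq; apply/negP => /qmin; rewrite leqNgt => /negP[].
apply: proper_card; apply/properP; split.
  by apply/fintype.subsetP => s; rewrite !inE => sr; exact: lt_trans rq.
by exists r; rewrite inE ?rq ?ltxx.
Qed.

(** At a minimal place where [g] is below [f], the value of [g] can be given to
    [f]. *)
Lemma descent_between f g r : f \in AA -> g \in AA -> (g r < f r)%N ->
  exists q, (q, g q) \in descents f.
Proof.
move=> fA gA gf.
have [q gq qmin] := @minimal_place [pred q | (g q < f q)%N] r gf.
exists q; apply/descentsP; split=> // [|s sq]; first exact: mem_values.
have := qmin s sq; rewrite inE -leqNgt => fg; apply: leq_trans fg _.
by apply: (AA_iso gA); exact: ltW.
Qed.

Definition weight f : nat := \sum_q f q.

Lemma weight_lt f g : (forall q, (f q <= g q)%N) -> f != g -> (weight f < weight g)%N.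
Proof.
move=> fg; apply: contraNltn => gf; apply/eqP/ffunP => q; apply/val_inj/eqP.
rewrite eqn_leq fg /= leqNgt; apply/negP => lt; move: gf; rewrite leqNgt => /negP[].
rewrite /weight (bigD1 q) //= [in X in (_ < X)%N](bigD1 q) //= -addSn leq_add //.
exact: leq_sum.
Qed.

Section LinearQuotients.
Variable K : fieldType.

Lemma lower_U f q a : Xvar K (q, a) * U_ K f = Xvar K (q, f q) * U_ K (lower f q a).
Proof.
rewrite /U_ (bigD1 q) //= [in RHS](bigD1 q) //= !ffunE eqxx mulrCA; congr (_ * (_ * _)).
by apply: eq_bigr => r /negbTE rq; rewrite ffunE rq.
Qed.

(** If [g] is [f] lowered at [q] to [a], then [X_(q, a) U_f = X_(q, f q) U_g].
    Conversely, every earlier monomial is divisible by the variable of a descent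
    of [f], while these variables generate a prime ideal that does not contain
    [U_f]. *)
Lemma colon_descents (fs : seq {ffun P -> 'I_n}) f c : f \in AA -> {subset fs <= AA} ->
  (forall g, g \in fs -> exists r, (g r < f r)%N) ->
  (forall q a, (q, a) \in descents f -> lower f q a \in fs) ->
  (c * U_ K f \in ideal_of [set` [seq U_ K g | g <- fs]]%classic) =
  (c \in ideal_of (vars (descents f) : set (mpoly #|{: T}| K))).
Proof.
move=> fA fsA fs_lt fs_lower; apply/idP/idP => [cf|/asboolP[s [Ds ->]]]; last first.
  rewrite mulr_suml big_seq.
  apply: (big_ind (fun z => z \in ideal_of [set` [seq U_ K g | g <- fs]]%classic)).
  - exact: ideal0.
  - by move=> y z; exact: idealD.
  move=> y /Ds[[q a] /= Dqa <-]; rewrite -mulrA lower_U mulrA; apply/idealM/ideal_gen.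
  by apply/mapP; exists (lower f q a) => //; exact: fs_lower.
rewrite -(@vars_colon _ _ _ _ (U_ K f)) //; last first.
  rewrite U_E kill_Xmon ?Xmon_neq0 // disjoint_subset.
  apply/fintype.subsetP => -[q a]; rewrite mem_graph /= !inE => /eqP ->.
  by rewrite /= ltnn andbF.
apply: ideal_sub cf => _ /mapP[g gfs ->].
have [r gf] := fs_lt g gfs; have [q qD] := descent_between fA (fsA _ gfs) gf.
rewrite /U_ (bigD1 q) //= mulrC; apply/idealM/ideal_gen.
by exists (q, g q).
Qed.

(** In the order of increasing weight, all lowerings of [f] come before [f], and no
    map above [f] does. *)
Lemma pdim_le_descents d : AA != finset.set0 ->
  (forall f, f \in AA -> (#|descents f| <= d)%N) -> pdim_le d (Lmodule K AA).
Proof.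
move=> AA0 Dd.
pose fs := sort (fun f g => weight f <= weight g)%N (enum AA).
have memfs f : (f \in fs) = (f \in AA) by rewrite mem_sort mem_enum.
have -> : Lmodule K AA = ideal_module [set` [seq U_ K f | f <- fs]]%classic :> lmodType _.
  rewrite /Lmodule; congr (ideal_module _ : lmodType _).
  apply/seteqP; split=> [_ [f /= fA <-]|_ /mapP[f ffs ->]].
    by apply/mapP; exists f; rewrite ?memfs.
  by exists f => //=; rewrite -memfs.
apply: pdim_le_linear_quotients.
- have [f fA] := finset.set0Pn _ AA0; rewrite -memfs in fA.
  by move: fA; case: (fs).
- by move=> _ /mapP[f _ ->]; rewrite U_E Xmon_neq0.
move=> us1 u us2 usE _.
have [fs1 [f [fs2 [fsE us1E uE]]]] : exists fs1 f fs2,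
    [/\ fs = fs1 ++ f :: fs2, us1 = [seq U_ K f | f <- fs1] & u = U_ K f].
  elim: (fs) us1 usE => [|f fs' IH] [|v us1] //=.
    by move=> [<- _]; exists [::], f, fs'.
  move=> [<- /IH[fs1 [g [fs2 [-> -> ->]]]]].
  by exists (f :: fs1), g, fs2.
have fA : f \in AA by rewrite -memfs fsE mem_cat mem_head orbT.
exists (descents f); first exact: Dd.
have srt : sorted (fun f g => weight f <= weight g)%N fs.
  by apply: sort_sorted => g h; exact: leq_total.
have ufs : uniq fs by rewrite sort_uniq enum_uniq.
have tr : transitive (fun f g => weight f <= weight g)%N.
  by move=> g h k; exact: leq_trans.
move: srt; rewrite fsE sorted_pairwise // pairwise_cat allrel_consr /= => /and3P[/andP[le1 _] _].
move=> /andP[le2 _].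
move: ufs; rewrite fsE cat_uniq /= negb_or => /and3P[_ /andP[ffs1 _] _].
move=> c; rewrite us1E uE; apply: colon_descents => // [g gfs|g gfs|q a Dqa].
- by rewrite -memfs fsE mem_cat gfs.
- apply: contrapT => /forallNP H.
  have fg q : (f q <= g q)%N by rewrite leqNgt; apply/negP/H.
  have /weight_lt : f != g by apply: contraNneq ffs1 => ->.
  by move=> /(_ fg); rewrite ltnNge (allP le1).
have : lower f q a \in fs by rewrite memfs lower_mem.
have /descentsP[_ af _] := Dqa.
have lt : (weight (lower f q a) < weight f)%N.
  apply: weight_lt => [r|]; first by rewrite ffunE; case: eqP => [->|_]; rewrite ?(ltnW af).
  by apply: contraTneq af => /ffunP/(_ q); rewrite ffunE eqxx => ->; rewrite ltnn.
rewrite fsE mem_cat inE => /or3P[//|/eqP lf|/(allP le2)].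
  by rewrite lf ltnn in lt.
by rewrite leqNgt lt.
Qed.

End LinearQuotients.

(** The extremal case of [card_descents]: every other value can be reached from
    [f] by lowering it at one place. *)
Definition apex f : Prop := f \in AA /\ cells \subset graph f :|: descents f.

Lemma card_graph f : #|graph f| = #|P|.
Proof. by rewrite card_imset // => q r []. Qed.

Lemma card_descents f : f \in AA -> (#|descents f| + #|P| <= #|cells|)%N /\
  (#|descents f| + #|P| = #|cells| -> apex f).
Proof.
move=> fA; have sub : graph f :|: descents f \subset cells.
  rewrite finset.subUset graph_cells //=.
  by apply/fintype.subsetP => x; rewrite inE => /andP[].
have card : #|graph f :|: descents f| = (#|descents f| + #|P|)%N.
  rewrite cardsU card_graph addnC (_ : _ :&: _ = finset.set0) ?cards0 ?subn0 //.
  apply/setP => -[q a]; rewrite !inE mem_graph /=; apply/negP => /andP[/eqP ->].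
  by rewrite ltnn andbF.
split=> [|cE]; first by rewrite -card subset_leq_card.
by split=> //; have/eqP <- : graph f :|: descents f == cells by rewrite eqEcard sub card -cE leqnn.
Qed.

Section Matching.
Variables (p0 : P) (b0 : 'I_n).
Hypothesis b0_mem : b0 \in values p0.
Hypothesis b0_max : forall a, a \in values p0 -> (a <= b0)%N.
Hypothesis no_apex : forall f, ~ apex f.
Local Notation v0 := (p0, b0).

Definition has_graph H : bool := [exists f in AA, graph f \subset H].

Definition least H : {ffun P -> 'I_n} :=
  odflt [ffun=> b0] [pick f | [&& f \in AA, graph f \subset H &
    [forall g, (g \in AA) && (graph g \subset H) ==> (weight f <= weight g)%N]]].

(** The pointwise minimum of two graphs in [H] is a graph in [H], so one of least
    weight is below all others. *)
Lemma leastP H : has_graph H -> [/\ least H \in AA, graph (least H) \subset H &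
  forall g, g \in AA -> graph g \subset H -> forall q, (least H q <= g q)%N].
Proof.
move=> /exists_inP[f0 f0A f0H]; rewrite /least; case: pickP => [f|none]; last first.
  have f0P : (f0 \in AA) && (graph f0 \subset H) by rewrite f0A.
  case: (@arg_minnP _ f0 (fun f => (f \in AA) && (graph f \subset H)) weight f0P).
  move=> f /andP[fA fH] fmin; have /negP[] := none f; rewrite fA fH /=.
  by apply/forallP => g; apply/implyP; exact: fmin.
rewrite /= => /and3P[fA fH /forallP fmin]; split=> // g gA gH.
pose h : {ffun P -> 'I_n} := [ffun q => if (f q <= g q)%N then f q else g q].
have hf q : (h q <= f q)%N by rewrite ffunE; have [//|/ltnW] := leqP (f q) (g q).
have hg q : (h q <= g q)%N by rewrite ffunE; have [|] := leqP (f q) (g q).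
have hH : graph h \subset H.
  apply/fintype.subsetP => -[q a]; rewrite mem_graph /= ffunE => /eqP ->.
  by case: ifP => _; [apply: (fintype.subsetP fH) | apply: (fintype.subsetP gH)];
    rewrite mem_graph.
have hA : h \in AA.
  apply: (AA_closed fA) => // [q r qr|q].
    rewrite [h r]ffunE; case: ifP => _.
      by apply: leq_trans (hf q) _; exact: (AA_iso fA).
    by apply: leq_trans (hg q) _; exact: (AA_iso gA).
  by rewrite ffunE; case: ifP => _; exact: mem_values.
have /eqP fh : h == f.
  apply: contraT => /(weight_lt hf); have := fmin h; rewrite hA hH /=.
  by rewrite ltnNge => ->.
by move=> q; rewrite -{1}fh.
Qed.

Lemma has_graphS H H' : H \subset H' -> has_graph H -> has_graph H'.
Proof.
move=> HH' /exists_inP[f fA fH]; apply/exists_inP; exists f => //.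
exact: fintype.subset_trans HH'.
Qed.

Lemma least_anti H H' q : H \subset H' -> has_graph H -> (least H' q <= least H q)%N.
Proof.
move=> HH' hH; have [lA lH _] := leastP hH.
have [_ _ min] := leastP (has_graphS HH' hH).
by apply: min => //; exact: fintype.subset_trans HH'.
Qed.

Lemma least_eq H H' : H \subset H' -> has_graph H -> graph (least H') \subset H ->
  least H = least H'.
Proof.
move=> HH' hH lH; have [_ _ min] := leastP hH.
have [lA _ _] := leastP (has_graphS HH' hH).
by apply/ffunP => q; apply/val_inj/eqP; rewrite eqn_leq min // least_anti.
Qed.

(** A vertex whose presence does not influence the least graph [f]; there is one
    because [f] is not an apex. *)
Definition critical f : T :=
  odflt v0 [pick x in cells :\: (graph f :|: descents f)].

Lemma criticalP f : f \in AA ->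
  [/\ critical f \in cells, critical f \notin graph f & critical f \notin descents f].
Proof.
move=> fA; rewrite /critical; case: pickP => [x|none].
  by rewrite !finset.inE negb_or -!andbA => /and3P[-> -> ->].
case: (@no_apex f); split=> //; apply/fintype.subsetP => x xC.
by have := none x; rewrite finset.in_setD xC andbT => /negbFE.
Qed.

(** Let [f] be the least graph of [H] and [g] that of the enlarged set. If [g]
    passed through the new vertex [(q, a)], this not being a descent of [f] would
    force [g] to be strictly below [f] at some place under [q]. The map that is
    [f] from [q] upwards and [g] elsewhere would then be a graph in [H] that is
    not above [f]. *)
Lemma least_critical H : has_graph H -> least (critical (least H) |: H) = least H.
Proof.
move=> hH; have [fA fH fmin] := leastP hH; set f := least H in fA fH fmin *.
set x := critical f; have [xC xf xD] := criticalP fA; rewrite -/x in xC xf xD.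
have hH' : has_graph (x |: H) by apply: has_graphS hH; exact: finset.subsetUr.
have [gA gH _] := leastP hH'; set g := least (x |: H) in gA gH *.
have gf q : (g q <= f q)%N by apply: least_anti => //; exact: finset.subsetUr.
have [xg|xg] := boolP (x \in graph g); last first.
  apply/esym/least_eq => //; first exact: finset.subsetUr.
  apply/fintype.subsetP => y yg; have := fintype.subsetP gH y yg.
  by rewrite in_setU1 => /orP[/eqP yx|//]; rewrite -yx yg in xg.
clearbody g x; case: x xC xf xD gH xg hH' => q a qC.
rewrite !mem_graph /= => af aD gH /eqP aE hH'; exfalso.
have afq : (a < f q)%N by rewrite ltn_neqAle (inj_eq val_inj) af aE gf.
have [r rq far] : exists2 r, (r < q)%O & (a < f r)%N.
  apply: contrapT => /forall2NP H0; case/negP: aD; apply/descentsP; split=> //.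
    by move: qC; rewrite inE.
  by move=> r rq; rewrite leqNgt; have [/(_ rq)|/negP] := H0 r.
pose h : {ffun P -> 'I_n} := [ffun s => if (q <= s)%O then f s else g s].
have hA : h \in AA.
  apply: (AA_closed fA) => [s t st|s|s]; rewrite !ffunE.
  - case: ifP => [qs|_]; first by rewrite (le_trans qs st) (AA_iso fA).
    by case: ifP => _; [apply: leq_trans (gf s) _; exact: (AA_iso fA) | exact: (AA_iso gA)].
  - by case: ifP => _; exact: mem_values.
  - by case: ifP.
have hH2 : graph h \subset H.
  apply/fintype.subsetP => -[s b]; rewrite mem_graph /= ffunE => /eqP ->.
  case: ifP => [_|qs]; first by apply: (fintype.subsetP fH); rewrite mem_graph.
  have : (s, g s) \in (q, a) |: H by apply: (fintype.subsetP gH); rewrite mem_graph.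
  by rewrite in_setU1 => /orP[/eqP[sq _]|//]; rewrite sq lexx in qs.
have := fmin h hA hH2 r; rewrite ffunE ifN; last by apply/negP => /(lt_le_trans rq); rewrite ltxx.
by move=> /leq_trans/(_ (AA_iso gA (ltW rq))); rewrite -aE leqNgt far.
Qed.

Definition avoid_complex : {set {set T}} :=
  [set F : {set T} | (F \subset cells) && has_graph (cells :\: F)]%SET.

(** The matching of the sets that are not faces, in terms of the complement [H] of
    such a set [F]. If [H] contains no graph even after [v0] is added, [v0] is
    toggled; these pairs are removed first. Otherwise adding [v0] creates a
    least graph [f], the critical vertex of [f] is toggled, and the pairs are
    removed by decreasing weight of [f]. *)
Definition removal_rank F : nat :=
  let H := v0 |: (cells :\: F) in
  if has_graph H then weight (least H) else (#|P| * n).+1.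

Definition removal_cell F : T :=
  let H := v0 |: (cells :\: F) in if has_graph H then critical (least H) else v0.

Lemma weight_bound f : (weight f <= #|P| * n)%N.
Proof.
rewrite /weight -sum_nat_const; apply: leq_sum => q _; exact/ltnW/ltn_ord.
Qed.

Lemma setD_toggle x F : x \in cells -> F \subset cells ->
  cells :\: toggle x F = toggle x (cells :\: F) :> {set T}.
Proof.
move=> xC FC; rewrite /toggle finset.in_setD xC andbT.
rewrite inE in xC.
by have [xF|xF] := boolP (x \in F); apply/setP => y; rewrite !finset.inE;
  have [->|] := eqVneq y x; rewrite ?xC ?xF ?(negbTE xF) //=.
Qed.

Lemma v0_cells : v0 \in cells. Proof. by rewrite inE. Qed.

Lemma toggle_subset x F : x \in cells -> F \subset cells -> toggle x F \subset cells.
Proof.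
move=> xC FC; rewrite /toggle; case: ifP => _.
  exact: fintype.subset_trans (subD1set _ _) FC.
by rewrite finset.subUset finset.sub1set xC.
Qed.

(** In the second case, toggling the critical vertex keeps [f] the least graph of
    [v0 |: H]. It creates no graph in [H]: such a graph would be above [f], which
    has the greatest possible value [b0] at [p0], so it would pass through [v0],
    which is not in [H]. *)
Lemma nonface_toggle F : F \subset cells -> ~~ has_graph (cells :\: F) ->
  [/\ removal_cell F \in cells, ~~ has_graph (cells :\: toggle (removal_cell F) F),
      removal_rank (toggle (removal_cell F) F) = removal_rank F & removal_cell (toggle (removal_cell F) F) = removal_cell F].
Proof.
move=> FC; rewrite /removal_rank /removal_cell; set H := cells :\: F => nH.
have [hvH|nvH] := boolP (has_graph (v0 |: H)); last first.
  rewrite (setD_toggle v0_cells FC) -/H.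
  have vE : v0 |: toggle v0 H = v0 |: H.
    rewrite /toggle; case: ifP => vH; first by rewrite finset.setD1K // (finset.setUidPr _) // finset.sub1set.
    by rewrite finset.setUA finset.setUid.
  rewrite vE (negbTE nvH); split=> //; first exact: v0_cells.
  by apply: contra nvH; apply: has_graphS; rewrite -vE finset.subsetUr.
have [fA fH fmin] := leastP hvH; set f := least _ in fA fH fmin *.
have [xC xf xD] := criticalP fA; rewrite (setD_toggle xC FC) -/H.
have lc := least_critical hvH; rewrite -/f in lc.
set x := critical f in xC xf xD lc *.
have v0f : v0 \in graph f.
  apply: contraR nH => v0f; apply/exists_inP; exists f => //.
  apply/fintype.subsetP => y yf; have := fintype.subsetP fH y yf.
  by rewrite in_setU1 => /orP[/eqP yv|//]; rewrite -yv yf in v0f.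
have v0H : v0 \notin H.
  by apply: contra nH => v0H; rewrite -(finset.setUidPr (_ : [set v0] \subset H)) // finset.sub1set.
have xv0 : x != v0 by apply: contraNneq xf => ->.
suff [nH' [hH' lH']] : ~~ has_graph (toggle x H) /\
    has_graph (v0 |: toggle x H) /\ least (v0 |: toggle x H) = f.
  by rewrite hH' lH'.
rewrite /toggle; case: ifP => xH.
  have sub : v0 |: (H :\ x) \subset v0 |: H by apply: finset.setUS; exact: subD1set.
  have fH' : graph f \subset v0 |: (H :\ x).
    apply/fintype.subsetP => y yf; have := fintype.subsetP fH y yf.
    rewrite !finset.inE => /orP[->//|->]; rewrite andbT orbC.
    by rewrite (contraNneq _ xf) // => <-.
  have hH' : has_graph (v0 |: (H :\ x)) by apply/exists_inP; exists f.
  split; first by apply: contra nH; apply: has_graphS; exact: subD1set.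
  by split=> //; exact: least_eq.
have UC : v0 |: (x |: H) = x |: (v0 |: H) by rewrite finset.setUCA.
have hH' : has_graph (v0 |: (x |: H)).
  by rewrite UC; apply: has_graphS hvH; exact: finset.subsetUr.
split; last by split=> //; rewrite UC.
apply/negP => /exists_inP[g gA gH].
have [_ _ min] := leastP hH'.
have bg : (f p0 <= g p0)%N.
  rewrite -lc -UC; apply: min => //; apply: fintype.subset_trans gH _.
  exact: finset.subsetUr.
have /eqP/= fb : v0.2 == f v0.1 by rewrite -mem_graph.
have gb : g p0 = b0.
  by apply/val_inj/eqP; rewrite eqn_leq {2}fb bg b0_max // mem_values.
have : v0 \in x |: H by apply: (fintype.subsetP gH); rewrite mem_graph gb.
by rewrite in_setU1 eq_sym (negbTE xv0) (negbTE v0H).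
Qed.

Lemma retract_avoid_complex (R : realType) : retract_onto R (finset.powerset cells) avoid_complex.
Proof.
have NP F : (F \in finset.powerset cells :\: avoid_complex) =
    (F \subset cells) && ~~ has_graph (cells :\: F).
  by rewrite finset.in_setD finset.powersetE !inE andbC; case: (F \subset cells).
have [f0 f0A f0p] : exists2 f0, f0 \in AA & f0 p0 = b0.
  by case/imsetP: b0_mem => f fA ->; exists f.
apply: (@retract_patchwork R _ _ _ removal_rank removal_cell).
- by move=> F G; rewrite !finset.powersetE => GC FG; exact: fintype.subset_trans GC.
- move=> F G; rewrite !inE => /andP[GC hG] FG.
  rewrite (fintype.subset_trans FG GC) /=; apply: has_graphS hG; exact: finset.setDS.
- by apply/fintype.subsetP => F; rewrite inE finset.powersetE => /andP[].
- rewrite inE finset.sub0set finset.setD0; apply/exists_inP; exists f0 => //; exact: graph_cells.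
- move=> F; rewrite !NP => /andP[FC nF].
  have [xC nH -> ->] := nonface_toggle FC nF.
  by split=> //; rewrite toggle_subset.
- move=> F G; rewrite !NP => /andP[FC nF] /andP[GC nG] FG.
  have sub : v0 |: (cells :\: G) \subset v0 |: (cells :\: F).
    by apply: finset.setUS; exact: finset.setDS.
  rewrite /removal_rank /removal_cell; have [hG|hG] := boolP (has_graph (v0 |: (cells :\: G))).
    rewrite (has_graphS sub hG); split.
      by apply: leq_sum => q _; exact: least_anti.
    move=> wE; congr critical; apply/eqP; apply: contraT => /weight_lt.
    by rewrite wE ltnn => /(_ (fun q => least_anti q sub hG)).
  case: ifP => hF; last by [].
  split; first by rewrite leqW ?weight_bound.
  by move=> wE; have := weight_bound (least (v0 |: (cells :\: F))); rewrite wE ltnn.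
Qed.

End Matching.

End Ideal.

(** * Poset ideals with an apex *)

Section Apex.
Variables (disp : Order.disp_t) (P : finPOrderType disp) (n : nat).
Local Notation T := (P * 'I_n)%type.
Implicit Types (g h : {ffun P -> 'I_n}) (q r : P) (a : 'I_n) (t : T) (H F : {set T}).
Variable AA : {set {ffun P -> 'I_n}}.
Hypothesis AA_iso : forall f, f \in AA -> isotone f.
Hypothesis AA_closed : forall f h, f \in AA -> isotone h ->
  (forall q, h q \in values AA q) -> (forall q, (h q <= f q)%N) -> h \in AA.
Variable f : {ffun P -> 'I_n}.
Hypothesis f_apex : apex AA f.

Lemma apex_le q r a : a \in values AA q -> (a <= f q)%N /\ ((r < q)%O -> (f r <= a)%N).
Proof.
have [fA sub] := f_apex => aq.
have : (q, a) \in cells AA by rewrite inE.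
move=> /(fintype.subsetP sub); rewrite inE mem_graph /= => /orP[/eqP ->|].
  by split=> // rq; apply: (AA_iso fA); exact: ltW.
by move=> /descentsP[_ af H]; split=> [|/H//]; exact: ltnW.
Qed.

(** An apex has the greatest value everywhere, and at each place all values are at
    least those of the apex at smaller places. Hence every choice of values is
    isotone and lies below the apex. *)
Lemma apex_full h : (forall q, h q \in values AA q) -> h \in AA.
Proof.
move=> hq; have [fA _] := f_apex; apply: (AA_closed fA) => // [q r|q]; last first.
  by have [] := apex_le q (hq q).
rewrite le_eqVlt => /orP[/eqP -> //|qr].
have [hf _] := apex_le q (hq q); have [_ /(_ qr) fh] := apex_le q (hq r).
exact: leq_trans fh.
Qed.

Lemma apex_avoid_complex F : (F \in avoid_complex AA) <->
  F \subset cells AA /\ forall q, exists2 a, a \in values AA q & (q, a) \notin F.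
Proof.
rewrite inE; split=> [/andP[-> /exists_inP[h hA hF]]|[-> HF]].
  split=> // q; exists (h q); first exact: mem_values.
  have : (q, h q) \in cells AA :\: F by apply: (fintype.subsetP hF); rewrite mem_graph.
  by rewrite !inE => /andP[].
have /choice[h hP] : forall q, exists a, a \in values AA q /\ (q, a) \notin F.
  by move=> q; have [a] := HF q; exists a.
pose h' : {ffun P -> 'I_n} := [ffun q => h q].
apply/exists_inP; exists h'.
  by apply: apex_full => q; rewrite ffunE; case: (hP q).
apply/fintype.subsetP => -[q a]; rewrite mem_graph /= ffunE => /eqP ->.
by have [aB aF] := hP q; rewrite !inE aF.
Qed.

(** As [AA] is a full product, the generators of the ideal are the products of one
    variable from each of the disjoint blocks [{(q, a) | a in B_q}]. *)
Lemma apex_degree_bound (K : fieldType) d : pdim_le d (Lmodule K AA) ->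
  (\sum_q (#|values AA q|.-1) <= d)%N.
Proof.
have [fA _] := f_apex.
pose block q := [seq (q, a) | a <- enum (values AA q)].
pose bs := [seq block q | q <- enum P].
move=> /koszul_degree_bound => /(_ bs).
have -> : sumn [seq (size b).-1 | b <- bs] = (\sum_q #|values AA q|.-1)%N.
  rewrite sumnE big_map big_map big_enum; apply: eq_bigr => q _.
  by rewrite size_map -cardE.
have szbs : size bs = #|P| by rewrite size_map -cardE.
apply.
- rewrite /bs; have := enum_uniq P; elim: (enum P) => [|q qs IHqs] //= /andP[qqs /IHqs uqs].
  rewrite cat_uniq uqs andbT map_inj_uniq ?enum_uniq => [|a b []//].
  apply/hasPn => -[r a] /flatten_mapP[s sqs /mapP[b _ [-> _]]].
  by apply/mapP => -[c _ [sq _]]; rewrite -sq sqs in qqs.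
- apply/mapP => -[q _]; apply/eqP; rewrite eq_sym -size_eq0 size_map -cardE cards_eq0.
  by apply/finset.set0Pn; exists (f q); exact: mem_values.
- move=> xs allxs.
  have [h hB ->] : exists2 h : {ffun P -> 'I_n}, (forall q, q \in enum P -> h q \in values AA q) &
      xs = [seq (q, h q) | q <- enum P].
    move: allxs; rewrite /bs; have := enum_uniq P.
    elim: (enum P) xs => [|q qs IHqs] [|x xs] //=; first by exists f.
    move=> /andP[qqs /IHqs IH] /andP[/mapP[a aB ->] /IH[h hB hE]].
    exists [ffun r => if r == q then a else h r].
      move=> r; rewrite ffunE inE; case: eqP => [->|_ /=]; last exact: hB.
      by move=> _; rewrite mem_enum in aB.
    rewrite ffunE eqxx hE; congr (_ :: _); apply/eq_in_map => r rqs.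
    by rewrite ffunE; case: eqP rqs => // ->; rewrite (negbTE qqs).
  apply: ideal_gen; exists h.
    by apply: apex_full => q; apply: hB; rewrite mem_enum.
  by rewrite big_map big_enum.
- move=> _ [g gA <-]; exists 1; rewrite mulr1 szbs /U_ rmorph_prod /=.
  by rewrite (eq_bigr _ (fun q _ => diag_Xvar _ _)) prodr_const.
Qed.

Variable R : realType.
Local Notation rV := 'rV[R]_#|{: T}|.
Local Notation W := (cells AA :\: graph f).
Local Notation k := #|W|.
Implicit Types (x : rV) (w : 'rV[R]_k) (j : 'I_k).

Definition base t : T := (t.1, f t.1).

(** The coordinates relative to the base vertex of the block; [raise_pt] is the
    inverse, which shifts each block so that its least coordinate becomes [0]. *)
Definition flatten_pt x : 'rV[R]_k :=
  \row_j (crd x (enum_val j) - crd x (base (enum_val j))).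

Definition height w t : R := \sum_(j | enum_val j == t) w 0 j.

(** The neutral element [0] of the minimum stands for the base vertex. *)
Definition floor_of w q : R := \big[Num.min/0]_(j | (enum_val j).1 == q) w 0 j.

Definition raise_pt w : rV :=
  \row_i ((height w (enum_val i) - floor_of w (enum_val i).1) *+ (enum_val i \in cells AA)).

Lemma crd_raise w t :
  crd (raise_pt w) t = (height w t - floor_of w t.1) *+ (t \in cells AA).
Proof. by rewrite /crd mxE enum_rankK. Qed.

Lemma height_val w j : height w (enum_val j) = w 0 j.
Proof.
rewrite /height (eq_bigl (pred1 j)) ?big_pred1_eq // => i /=.
by rewrite (inj_eq enum_val_inj).
Qed.

Lemma height_out w t : t \notin W -> height w t = 0.
Proof.
move=> tW; rewrite /height big1 // => j /eqP jt; case/negP: tW.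
by rewrite -jt; exact: enum_valP.
Qed.

Lemma base_cells t : t \in cells AA -> base t \in cells AA.
Proof. by move=> _; rewrite inE mem_values //; case: f_apex. Qed.

Lemma height_base w t : height w (base t) = 0.
Proof. by apply: height_out; rewrite !inE mem_graph /= eqxx. Qed.

Lemma raiseK w : flatten_pt (raise_pt w) = w.
Proof.
apply/rowP => j; rewrite mxE !crd_raise.
have jW := enum_valP j; have jC : enum_val j \in cells AA by case/finset.setDP: jW.
by rewrite jC base_cells // !mulr1n height_base height_val sub0r opprK subrK.
Qed.

Lemma raise_ge0 w t : 0 <= crd (raise_pt w) t.
Proof.
rewrite crd_raise; case: (t \in cells AA) => //; rewrite mulr1n subr_ge0.
have [tW|tW] := boolP (t \in W); last by rewrite height_out // bigmin_le_id.
have [j ->] : exists j : 'I_k, t = enum_val j.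
  by exists (enum_rank_in tW t); rewrite enum_rankK_in.
by rewrite height_val; apply: bigmin_le_cond.
Qed.

Lemma raise_zero w q : exists2 a, a \in values AA q & crd (raise_pt w) (q, a) = 0.
Proof.
have [fA _] := f_apex.
have : floor_of w q = 0 \/ exists2 j, (enum_val j).1 == q & floor_of w q = w 0 j.
  rewrite /floor_of.
  apply: (big_ind (fun z => z = 0 \/ exists2 j, (enum_val j).1 == q & z = w 0 j)).
  - by left.
  - by move=> y z Hy Hz; case: leP.
  - by move=> j jq; right; exists j.
move=> [fl0|[j /eqP jq fl]].
  exists (f q); first exact: mem_values.
  by rewrite crd_raise inE mem_values //= (height_base w (q, f q)) fl0 subrr mul0rn.
have jW := enum_valP j; have jC : enum_val j \in cells AA by case/finset.setDP: jW.
exists (enum_val j).2; first by rewrite -jq; move: jC; rewrite inE.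
have -> : (q, (enum_val j).2) = enum_val j by rewrite -jq -surjective_pairing.
by rewrite crd_raise height_val jC jq fl subrr.
Qed.

Lemma raise_supp w : supp (raise_pt w) \in avoid_complex AA.
Proof.
apply/apex_avoid_complex; split=> [|q].
  apply/fintype.subsetP => t; rewrite inE crd_raise; case: (t \in cells AA) => //.
  by rewrite mulr0n eqxx.
have [a aB a0] := raise_zero w q; exists a => //.
by rewrite inE a0 eqxx.
Qed.

(** A face of the complex omits a vertex of every block, so the least coordinate
    of each block is [0] and the shift recovers the base coordinate. *)
Lemma flattenK x : realization (avoid_complex AA) x -> raise_pt (flatten_pt x) = x.
Proof.
move=> /realizationP[x0 _ /apex_avoid_complex[xC xzero]].
have crdE t : t \in cells AA -> height (flatten_pt x) t = crd x t - crd x (base t).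
  move=> tC; have [tW|tW] := boolP (t \in W).
    have [j ->] : exists j : 'I_k, t = enum_val j.
      by exists (enum_rank_in tW t); rewrite enum_rankK_in.
    by rewrite height_val mxE.
  rewrite height_out //; move: tW; rewrite !inE negb_and negbK.
  have := tC; rewrite inE => ->; rewrite orbF mem_graph => /eqP tf.
  by rewrite /base -tf -surjective_pairing subrr.
have floorE q : floor_of (flatten_pt x) q = - crd x (q, f q).
  apply/eqP; rewrite eq_le; apply/andP; split; last first.
    apply/bigmin_geP; split=> [|j /eqP jq]; first by rewrite oppr_le0.
    by rewrite mxE /base jq lerDr.
  have [a aB] := xzero q; rewrite inE negbK => /eqP xa.
  have [af|af] := eqVneq a (f q).
    by rewrite -af xa oppr0 bigmin_le_id.
  have aW : (q, a) \in W by rewrite !inE mem_graph /= af aB.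
  have jE : enum_val (enum_rank_in aW (q, a)) = (q, a) by rewrite enum_rankK_in.
  have -> : - crd x (q, f q) = flatten_pt x 0 (enum_rank_in aW (q, a)).
    by rewrite mxE jE xa sub0r.
  by apply: bigmin_le_cond; rewrite jE.
apply/rowP => i; rewrite -(enum_valK i) -!/(crd _ _) crd_raise floorE.
have [tC|tC] := boolP (enum_val i \in cells AA).
  by rewrite crdE // opprK subrK.
have : enum_val i \notin supp x by apply: contra tC; exact: (fintype.subsetP xC).
by rewrite inE negbK mulr0n => /eqP.
Qed.

Lemma floorZ c w q : 0 <= c -> floor_of (c *: w) q = c * floor_of w q.
Proof.
move=> c0; rewrite /floor_of (big_morph (fun z => c * z) (id1 := 0) (op1 := Num.min)).
- by apply: eq_bigr => j _; rewrite mxE.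
- by move=> y z; rewrite minr_pMr.
- by rewrite mulr0.
Qed.

Lemma raiseZ c w : 0 <= c -> raise_pt (c *: w) = c *: raise_pt w.
Proof.
move=> c0; apply/rowP => i; rewrite !mxE floorZ //.
have -> : height (c *: w) (enum_val i) = c * height w (enum_val i).
  by rewrite /height mulr_sumr; apply: eq_bigr => j _; rewrite mxE.
by rewrite -mulrBr mulrnAr.
Qed.

Lemma flattenZ c x : flatten_pt (c *: x) = c *: flatten_pt x.
Proof. by apply/rowP => j; rewrite !mxE /crd !mxE mulrBr. Qed.

Lemma flatten_cont : continuous flatten_pt.
Proof.
move=> x; have FF : Filter (nbhs x) by exact: nbhs_filter.
apply: (cvg_row FF) => j; rewrite mxE; under eq_fun do rewrite mxE.
by apply: cvgB; exact: crd_cont.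
Qed.

Lemma raise_cont : continuous raise_pt.
Proof.
move=> w; have FF : Filter (nbhs w) by exact: nbhs_filter.
apply: (cvg_row FF) => i; rewrite mxE -mulr_natr.
under eq_fun do rewrite mxE -mulr_natr.
apply: cvgM; last exact: cvg_cst.
apply: cvgB.
  by apply: continuous_sum => j _; exact: coord_cont.
by apply: continuous_bigmin => j _; exact: coord_cont.
Qed.

Definition total (x : rV) : R := \sum_j x 0 j.

(** The maps [flatten_pt] and [raise_pt] are continuous, positively homogeneous
    and inverse to each other on the cone over the complex, so they give
    inverse homeomorphisms after normalisation. *)
Lemma apex_sphere : simplicial_sphere R (avoid_complex AA).
Proof.
pose nrm (w : 'rV[R]_k) : R := Num.sqrt (\sum_j w 0 j ^+ 2).
have nrmZ c w : 0 <= c -> nrm (c *: w) = c * nrm w.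
  move=> c0; rewrite /nrm -{2}(ger0_norm c0) -sqrtr_sqr -sqrtrM ?sqr_ge0 //.
  by congr Num.sqrt; rewrite mulr_sumr; apply: eq_bigr => j _; rewrite mxE exprMn.
have nrm_cont : continuous nrm.
  move=> w; pose sq (v : 'rV[R]_k) : R := \sum_j v 0 j ^+ 2.
  apply: (@continuous_comp _ _ _ sq Num.sqrt); last exact: sqrt_continuous.
  apply: continuous_sum => i _ v.
  change ((fun v : 'rV[R]_k => v 0 i * v 0 i) @ v --> v 0 i * v 0 i)%classic.
  exact: (cvgM (@coord_cont R k i v) (@coord_cont R k i v)).
have nrm_gt0 w : w != 0 -> 0 < nrm w.
  move=> w0; rewrite sqrtr_gt0 lt_def sumr_ge0 ?andbT => [|j _]; last exact: sqr_ge0.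
  apply: contra w0; rewrite psumr_eq0 => [/allP H|j _]; last exact: sqr_ge0.
  apply/eqP/rowP => j; have := H j (mem_index_enum _).
  by rewrite mxE sqrf_eq0 => /eqP.
have raise0 : raise_pt 0 = 0 by have := raiseZ 0 (lexx 0); rewrite !scale0r.
have flatten0 : flatten_pt 0 = 0 by have := flattenZ 0 0; rewrite !scale0r.
have flatten_neq0 x : realization (avoid_complex AA) x -> flatten_pt x != 0.
  move=> xD; apply/eqP => x0; have := flattenK xD; rewrite x0 raise0 => xE.
  case: xD => _ + _; rewrite -xE big1 => [/eqP|j _]; last by rewrite mxE.
  by rewrite eq_sym oner_eq0.
have total_gt0 w : unit_sphere w -> 0 < total (raise_pt w).
  move=> w1; have w_neq0 : raise_pt w != 0.
    apply/eqP => r0; have := raiseK w; rewrite r0 flatten0 => wE; move: w1.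
    rewrite /unit_sphere /= -wE big1 ?sqrtr0 => [/eqP|j _]; last by rewrite mxE expr0n.
    by rewrite eq_sym oner_eq0.
  have ge0 (i : 'I_#|{: T}|) : 0 <= raise_pt w 0 i.
    by rewrite -(enum_valK i); exact: raise_ge0.
  rewrite lt_def sumr_ge0 ?andbT //; apply: contra w_neq0.
  rewrite psumr_eq0 // => /allP H; apply/eqP/rowP => j.
  by rewrite [RHS]mxE; apply/eqP; exact: H j (mem_index_enum _).
have sum_cont m : continuous (fun x : 'rV[R]_m => \sum_j x 0 j) := @sum_coord_cont R m.
exists k, (fun x => (nrm (flatten_pt x))^-1 *: flatten_pt x),
  (fun w => (total (raise_pt w))^-1 *: raise_pt w); split.
- apply/subspace_continuousP => x xD.
  have FF : Filter (nbhs x) by exact: nbhs_filter.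
  apply: cvg_within_filter; apply: (cvg_row FF) => j.
  rewrite mxE; under eq_fun do rewrite mxE.
  have cj : {for x, continuous (fun x => flatten_pt x 0 j)}.
    apply: (@continuous_comp _ _ _ flatten_pt (fun w => w 0 j)); first exact: flatten_cont.
    exact: coord_cont.
  apply: cvgM; last exact: cj.
  apply: cvgV; first by rewrite gt_eqF // nrm_gt0 // flatten_neq0.
  apply: (@continuous_comp _ _ _ flatten_pt nrm); first exact: flatten_cont.
  exact: nrm_cont.
- apply/subspace_continuousP => w w1.
  have FF : Filter (nbhs w) by exact: nbhs_filter.
  apply: cvg_within_filter; apply: (cvg_row FF) => j.
  rewrite mxE; under eq_fun do rewrite mxE.
  have cj : {for w, continuous (fun w => raise_pt w 0 j)}.
    apply: (@continuous_comp _ _ _ raise_pt (fun x => x 0 j)); first exact: raise_cont.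
    exact: coord_cont.
  apply: cvgM; last exact: cj.
  apply: cvgV; first by rewrite gt_eqF // total_gt0.
  apply: (@continuous_comp _ _ _ raise_pt total); first exact: raise_cont.
  exact: sum_cont.
- move=> x xD; have n0 := nrm_gt0 _ (flatten_neq0 _ xD).
  have ni0 : 0 <= (nrm (flatten_pt x))^-1 by rewrite invr_ge0 ltW.
  split; first by rewrite /unit_sphere /= -/(nrm _) nrmZ // mulVf ?gt_eqF.
  have x1 : total x = 1 by case: xD.
  rewrite raiseZ // flattenK // /total.
  under eq_bigr do rewrite mxE.
  rewrite -mulr_sumr -/(total x) x1 mulr1 invrK scalerA mulfV ?gt_eqF //.
  by rewrite scale1r.
- move=> w w1; have t0 := total_gt0 w w1.
  have ti0 : 0 < (total (raise_pt w))^-1 by rewrite invr_gt0.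
  split.
    apply/realizationP; split=> [t||].
    + by rewrite /crd mxE mulr_ge0 ?(ltW ti0) // raise_ge0.
    + rewrite crd_sum; under eq_bigr do rewrite mxE.
      by rewrite -mulr_sumr mulVf // gt_eqF.
    + rewrite (_ : supp _ = supp (raise_pt w)) ?raise_supp //.
      by apply/setP => t; rewrite !inE /crd mxE mulf_eq0 (gt_eqF ti0).
  rewrite flattenZ raiseK nrmZ ?(ltW ti0) //.
  have -> : nrm w = 1 by exact: w1.
  by rewrite mulr1 invrK scalerA mulfV ?gt_eqF // scale1r.
Qed.

End Apex.

(** * The invariants of the statement *)

Section PosetIdeal.
Variables (disp : Order.disp_t) (P : finPOrderType disp) (m n : nat) (p : 'I_m -> P).
Hypothesis p_bij : bijective p.
Variables (A : 'I_m -> {set 'I_n}) (AA : {set {ffun P -> 'I_n}}).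
Hypothesis AA_ideal : poset_ideal (@lehom disp P n) (HomP p A) AA.

Lemma ideal_isotone f : f \in AA -> isotone f.
Proof.
have [_ /fintype.subsetP sub _] := AA_ideal.
move=> /sub; rewrite inE => /andP[/forallP iso _] q r qr.
by have /forallP/(_ r)/implyP := iso q; exact.
Qed.

Lemma Bset_values i : Bset p A AA i = values AA (p i).
Proof.
have [_ /fintype.subsetP sub _] := AA_ideal.
apply/setP => a; rewrite !inE; apply/andP/imsetP => [[_ /exists_inP[f fA /eqP <-]]|[f fA ->]].
  by exists f.
split; last by apply/exists_inP; exists f.
by have := sub f fA; rewrite inE => /andP[_ /forallP/(_ i)].
Qed.

Lemma ideal_lower f h : f \in AA -> isotone h ->
  (forall q, h q \in values AA q) -> (forall q, (h q <= f q)%N) -> h \in AA.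
Proof.
have [_ _ low] := AA_ideal; move=> fA iso hv hf; apply: (low _ f) => //.
  rewrite inE; apply/andP; split.
    by apply/forallP => q; apply/forallP => r; apply/implyP; exact: iso.
  apply/forallP => i; have := hv (p i); rewrite -Bset_values inE.
  by case/andP.
by apply/forallP.
Qed.

Lemma Vset_cells : Vset p A AA = cells AA.
Proof.
have [p' pK p'K] := p_bij.
apply/setP => -[q a]; rewrite inE; apply/bigcupP/idP => [[i _ /imsetP[b bB [-> ->]]]|aq].
  by rewrite /= -Bset_values.
exists (p' q) => //; apply/imsetP; exists a; rewrite ?p'K //.
by rewrite Bset_values p'K.
Qed.

Lemma Delta_avoid_complex (K : fieldType) : Delta p A K AA = avoid_complex AA.
Proof.
apply/setP => F; rewrite DeltaE Vset_cells inE.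
apply/exists_inP/andP => [[f fA]|[FC /exists_inP[f fA fF]]].
  rewrite finset.subsetD => /andP[FC dis]; split=> //; apply/exists_inP; exists f => //.
  by rewrite finset.subsetD disjoint_sym dis andbT (graph_cells fA).
exists f => //; rewrite finset.subsetD FC disjoint_sym.
by move: fF; rewrite finset.subsetD => /andP[].
Qed.

Lemma card_cells : #|cells AA| = (\sum_q #|values AA q|)%N.
Proof.
rewrite -sum1_card (eq_bigl (fun x => x.2 \in values AA x.1)) => [|x]; last by rewrite inE.
rewrite -(pair_big_dep xpredT (fun q a => a \in values AA q) (fun _ _ => 1%N)) /=.
by apply: eq_bigr => q _; rewrite sum1_card.
Qed.

Lemma sum_Bset : (\sum_(i < m) #|Bset p A AA i| - m = #|cells AA| - #|P|)%N.
Proof.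
have -> : #|P| = m by rewrite -(bij_eq_card p_bij) card_ord.
rewrite card_cells (reindex p) /=; last exact: onW_bij.
by congr (_ - _)%N; apply: eq_bigr => i _; rewrite Bset_values.
Qed.

Lemma sum_values_predn : (\sum_q #|values AA q|.-1 = #|cells AA| - #|P|)%N.
Proof.
have [AA0 _ _] := AA_ideal; have [f fA] := finset.set0Pn _ AA0.
rewrite card_cells -sum1_card -sumnB => [|q _].
  by apply: eq_bigr => q _; rewrite subn1.
by rewrite card_gt0; apply/finset.set0Pn; exists (f q); exact: mem_values.
Qed.

End PosetIdeal.

Theorem corollary6p6 (K : fieldType) (R : realType) (n : nat) (n_gt0 : (0 < n)%N)
    (disp : Order.disp_t) (P : finPOrderType disp) (m : nat) (p : 'I_m -> P)
    (p_bij : bijective p)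
    (p_lt : forall i j : 'I_m, (p i < p j)%O -> (i < j)%N)
    (A : 'I_m -> {set 'I_n}) (A_neq0 : forall i : 'I_m, A i != finset.set0)
    (AA : {set {ffun P -> 'I_n}})
    (AA_ideal : poset_ideal (@lehom disp P n) (HomP p A) AA) :
  pd_le (Lmodule K AA) (\sum_(i < m) #|Bset p A AA i| - m)%N /\
  (pd_eq (Lmodule K AA) (\sum_(i < m) #|Bset p A AA i| - m)%N <->
   simplicial_sphere R (Delta p A K AA)).
Proof.
rewrite (sum_Bset p_bij AA_ideal) (Delta_avoid_complex p_bij AA_ideal).
have [AA0 _ _] := AA_ideal; have [f0 f0A] := finset.set0Pn _ AA0.
have iso := ideal_isotone AA_ideal; have low := ideal_lower AA_ideal.
set N := (#|cells AA| - #|P|)%N.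
have DN f : f \in AA -> (#|descents AA f| <= N)%N.
  by move=> /card_descents[le _]; rewrite leq_subRL ?(leq_trans (leq_addl _ _) le) // addnC.
have pdN : pdim_le N (Lmodule K AA) by apply: pdim_le_descents.
split; first exact: pdim_le_pd_le.
have [[f f_apex]|no_apex] := pselect (exists f, apex AA f).
  split=> _; first exact: (apex_sphere iso low f_apex).
  split=> [|e /proj_resolution_pdim_le/(apex_degree_bound iso low f_apex)].
    exact/proj_resolution_pdim_le.
  by rewrite (sum_values_predn AA_ideal).
have DltN f : f \in AA -> (#|descents AA f| < N)%N.
  move=> fA; have [le eqN] := card_descents fA.
  rewrite ltn_subRL addnC ltn_neqAle le andbT.
  by apply/eqP => /eqN f_apex; apply: no_apex; exists f.
have N_gt0 : (0 < N)%N by apply: leq_ltn_trans (DltN f0 f0A).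
have [[p1 b1] b1C] : exists x, x \in cells AA.
  by apply/finset.set0Pn; rewrite -card_gt0 (leq_trans N_gt0) // leq_subr.
have b1v : b1 \in values AA p1 by rewrite inE in b1C.
(* Any place with its greatest value serves as the vertex v0 of the matching. *)
case: (@arg_maxnP _ b1 [in values AA p1] (@nat_of_ord n) b1v) => b0 b0v b0max.
split=> [[_ minN]|].
  have : (N <= N.-1)%N.
    apply/minN/proj_resolution_pdim_le/pdim_le_descents => // f /DltN ltN.
    by rewrite -ltnS prednK.
  by rewrite leqNgt ltn_predL N_gt0.
have sub : avoid_complex AA \subset finset.powerset (cells AA).
  by apply/fintype.subsetP => F; rewrite inE finset.powersetE => /andP[].
move=> sph; exfalso; apply: (@not_sphere R _ (cells AA) (avoid_complex AA) _ _ sub _ sph).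
- by apply/finset.set0Pn; exists (p1, b1).
- move=> F G; rewrite !inE => /andP[GC hG] FG.
  rewrite (fintype.subset_trans FG GC) /=; apply: has_graphS hG; exact: finset.setDS.
- apply: (retract_avoid_complex iso low b0v) => [a av|f f_apex]; first exact: b0max.
  by apply: no_apex; exists f.
Qed.
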